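(* Let $\alpha>0$. Let $\{d_n\}_{n\ge1}$, $\{b_n\}_{n\ge1}$ be real random variables, all independent, and let $\{m_k\}_{k\ge0}$ be a real sequence with $m_0=1$ such that $\lim_{n\to\infty}\mathbb{E}[(b_n/n^\alpha)^k]=m_k$ and $\sup_{n\ge1}\mathbb{E}[|d_n|^k]<\infty$ for every integer $k\ge0$. Assume in addition that there exist $0<\upsilon\le\min(1,2\alpha)$ and real numbers $\sigma_d$ and $\xi_k$ ($k\ge0$) such that $$\lim_{n\to\infty}n^{\upsilon}\left(\mathbb{E}[(b_n/n^\alpha)^k]-m_k\right)=\xi_k\quad\text{for all }k\ge0,$$ $$\mathbb{E}[d_n]=0\ \text{ for all }n,\qquad \lim_{n\to\infty}\mathrm{var}(d_n)=\sigma_d^2 .$$ Let $A_n$ be the symmetric tridiagonal matrix built from these variables as in the context, $X_n=n^{-\alpha}A_n$, and let $L_k$ be as in the context. For $\gamma\in\Gamma_k$ write $$M(\gamma)=\prod_{i<0}m_{\mathbbm{l}_i(\gamma)},\qquad \Xi(\gamma)=\sum_{j<0}\xi_{\mathbbm{l}_j(\gamma)}\prod_{i<0,\,i\ne j}m_{\mathbbm{l}_i(\gamma)},$$ and write also $M(\gamma)=\prod_{i<0}m_{\mathbbm{l}_i(\gamma)}$ for $\gamma\in\Gamma_k^{2,-}$. Then for each $k\ge0$ the limit $$\lim_{n\to\infty}n^{\upsilon}\left(\mathbb{E}[\mathrm{tr}_n(X_n^k)]-L_k\right)$$ exists and equals: - $0$ if $k$ is odd or $k=0$; - if $k\ge2$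 is even and $\upsilon<\min(1,2\alpha)$: $\displaystyle\frac{1}{\alpha k-\upsilon+1}\sum_{\gamma\in\Gamma_k}\Xi(\gamma)$; - if $k\ge2$ is even and $\upsilon=2\alpha<1$: $\displaystyle\frac{1}{\alpha k-\upsilon+1}\Big(\sigma_d^2\sum_{\gamma\in\Gamma_k^{2,-}}M(\gamma)+\sum_{\gamma\in\Gamma_k}\Xi(\gamma)\Big)$; - if $k\ge2$ is even and $\upsilon=1<2\alpha$: $\displaystyle\frac{\alpha k+1}{2}L_k+\frac1k\sum_{\gamma\in\Gamma_k}\Big(\sum_{i<0}i\,\mathbbm{l}_i(\gamma)\Big)M(\gamma)+\frac{1}{\alpha k}\sum_{\gamma\in\Gamma_k}\Xi(\gamma)$; - if $k\ge2$ is even and $\upsilon=1=2\alpha$: $\displaystyle\frac{k+2}{4}L_k+\frac1k\sum_{\gamma\in\Gamma_k}\Big(\sum_{j<0}j\,\mathbbm{l}_j(\gamma)\Big)M(\gamma)+\frac{2}{k}\sigma_d^2\sum_{\gamma\in\Gamma_k^{2,-}}M(\gamma)+\frac2k\sum_{\gamma\in\Gamma_k}\Xi(\gamma)$.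
   Context: Matrix model: $A_n$ is the $n\times n$ symmetric tridiagonal matrix whose diagonal entries, from top to bottom, are $d_n,d_{n-1},\dots,d_1$ and whose off-diagonal entries, from top to bottom, are $b_{n-1},\dots,b_1$; all other entries are $0$. All moments of the variables are understood to be finite. $\mathrm{tr}_n(Y)=\frac1n\sum_{i=1}^n y_{i,i}$. Paths: for $k\ge1$, $\mathcal{P}_k$ is the set of $\gamma=(j_1,\dots,j_{k+1})\in\mathbb{Z}^{k+1}$ with $j_1=j_{k+1}$ and $|j_u-j_{u+1}|\le1$ for $1\le u\le k$. A flat step at level $i$ is a $u$ with $j_u=j_{u+1}=i$. $\Gamma_k$ is the set of $\gamma\in\mathcal{P}_k$ with $\max_u j_u=0$ and no flat steps (i.e. $|j_u-j_{u+1}|=1$ for all $u$). $\Gamma_k^{2,-}$ is the set of $\gamma\in\mathcal{P}_k$ with $\max_u j_u=0$ and exactly two flat steps, both at the same level. $\Gamma_0=\{(0)\}$. $\mathbbm{l}_i(\gamma)$ is the number of $u\in\{1,\dots,k\}$ with $\{j_u,j_{u+1}\}=\{i,i+1\}$. $L_k=0$ for $k$ odd, and $L_k=\frac{1}{\alpha k+1}\sum_{\gamma\in\Gamma_k}\prod_{i<0}m_{\mathbbm{l}_i(\gamma)}$ for $k$ even. Note $\xi_0=0$, so all sums and products over levels are effectively finite. *)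

(* Defs.v *)
From mathcomp Require Export all_boot all_order all_algebra.
From mathcomp Require Export all_classical all_reals all_analysis.

Set Implicit Arguments.
Unset Strict Implicit.
Unset Printing Implicit Defensive.

Import Order.TTheory GRing.Theory Num.Theory.
Import numFieldNormedType.Exports.

Local Open Scope classical_set_scope.
Local Open Scope ring_scope.

(* Mutual independence: the product rule over every finite subfamily. *)
Definition mutually_independent (disp : measure_display)
    (T : measurableType disp) (R : realType) (P : probability T R)
    (I : choiceType) (X : I -> {RV P >-> R}) : Prop :=
  forall (s : seq I) (B : I -> set R), uniq s ->
    (forall i, measurable (B i)) ->
    P (\bigcap_(i in [set` s]) (X i @^-1` B i)) =
      (\prod_(i <- s) P (X i @^-1` B i))%E.

Definition finite_moments (disp : measure_display)
    (T : measurableType disp) (R : realType) (P : probability T R)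
    (X : {RV P >-> R}) : Prop :=
  forall k : nat, P.-integrable setT (fun w => (X w ^+ k)%:E).

(* The joint family d_1, d_2, ..., b_1, b_2, ...; terms of index 0 are never
   used. *)
Definition joint_family (S : Type) (d b : nat -> S) (i : nat + nat) : S :=
  match i with inl n => d n.+1 | inr n => b n.+1 end.

(* With rows and columns numbered from 0, entry (i, i) is d_{n-i} and entries
   (i, i+1), (i+1, i) are b_{n-1-i}. *)
Definition tridiag (R : nzRingType) (d b : nat -> R) (n : nat) : 'M[R]_n :=
  \matrix_(i < n, j < n)
    if i == j then d (n - i)%N
    else if (i.+1 == j :> nat) then b (n - j)%N
    else if (j.+1 == i :> nat) then b (n - i)%N
    else 0.

Definition ntrace (R : fieldType) (n : nat) (Y : 'M[R]_n) : R :=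
  n%:R^-1 * \tr Y.

Definition scaled_tridiag (R : realType) (alpha : R) (d b : nat -> R)
    (n : nat) : 'M[R]_n :=
  n%:R `^ (- alpha) *: tridiag d b n.

(* The path (j_1, ..., j_{k+1}) is the tuple g with g`_u = j_{u+1}. *)
Definition is_path (k : nat) (g : k.+1.-tuple int) : Prop :=
  g`_0 = g`_k /\ forall u : 'I_k, `|g`_u - g`_u.+1| <= 1.

Definition path_max (k : nat) (g : k.+1.-tuple int) : int :=
  \big[Num.max/g`_0]_(u < k.+1) g`_u.

Definition flat_steps (k : nat) (g : k.+1.-tuple int) : {set 'I_k} :=
  [set u : 'I_k | g`_u == g`_u.+1]%SET.

(* For k = 0 this is {(0)}. *)
Definition Gamma (k : nat) : set (k.+1.-tuple int) :=
  [set g | [/\ is_path g, path_max g = 0 & flat_steps g = finset.set0]].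
Arguments Gamma k : clear implicits.

Definition Gamma2 (k : nat) : set (k.+1.-tuple int) :=
  [set g | [/\ is_path g, path_max g = 0, #|flat_steps g| = 2%N &
    forall u v, u \in flat_steps g -> v \in flat_steps g -> g`_u = g`_v]].
Arguments Gamma2 k : clear implicits.

Definition crossings (k : nat) (g : k.+1.-tuple int) (i : int) : nat :=
  #|[set u : 'I_k | ((g`_u == i) && (g`_u.+1 == i + 1)) ||
                    ((g`_u == i + 1) && (g`_u.+1 == i))]%SET|.

(* Products and sums over all levels i < 0 run over the finite support of the
   summand (an infinite support would give the neutral element). The weights
   below are meant for m 0 = 1 and xi 0 = 0; the supports are then finite, since
   crossings g i = 0 for all but finitely many i. *)
Definition Mweight (R : realType) (m : nat -> R) (k : nat)
    (g : k.+1.-tuple int) : R :=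
  \big[*%R/1]_(i \in [set i : int | i < 0]) m (crossings g i).

Definition Xiweight (R : realType) (m xi : nat -> R) (k : nat)
    (g : k.+1.-tuple int) : R :=
  \sum_(j \in [set j : int | j < 0])
    xi (crossings g j) *
    \big[*%R/1]_(i \in [set i : int | i < 0 /\ i <> j]) m (crossings g i).

Definition level_sum (R : realType) (k : nat) (g : k.+1.-tuple int) : R :=
  \sum_(i \in [set i : int | i < 0]) (i%:~R * (crossings g i)%:R : R).

Definition limit_moment (R : realType) (alpha : R) (m : nat -> R)
    (k : nat) : R :=
  if odd k then 0
  else (alpha * k%:R + 1)^-1 * \sum_(g \in Gamma k) Mweight m g.

(* Main.v *)
Require Import Defs.
From mathcomp Require Import all_boot all_order all_algebra.
From mathcomp Require Import all_classical all_reals all_analysis.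
From mathcomp Require Import finmap measurable_realfun.
From mathcomp Require Import ring lra zify.

(** The trace of the k-th power of the tridiagonal matrix of size n is a sum
    over closed walks of length k on its rows.  Row i sits at level n - i, and
    the entries met by a walk are the variables indexed by the levels it
    crosses.  Deleting row and column 0 of the matrix of size n + 1 leaves
    the matrix of size n, so the trace for size n is the sum over l = 1, ..., n
    of the weights of the walks of the matrix of size l that visit row 0
    (trace_tridiag_sum).  For l > k such a walk is just a path g with maximum 0,
    translated by l, with weight
      prod_i b_(l-i-1) ^ (crossings of the level -(i+1))
      * prod_i d_(l-i) ^ (flat steps at the level -i)
    (top_walks_weightE).  By independence the expectation of this weight is the
    product of the moments (independent_expectation_prod).  It therefore depends
    on l only: n enters through the normalisation and the summation range alone.

    Write p = alpha k and let u be the rate.  The relation expansion u x p q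
    below says x_n = p + q n^-u + o(n^-u); it is stable under products and
    shifts.  Divided by l^p, the mean weight of a path without flat step has
    such an expansion.  Its limit is M(g), and its second coefficient is Xi(g)
    plus, when u = 1, the term alpha (sum_i i l_i(g)) M(g) that comes from
    ((l + i) / l)^(alpha l_i) = 1 + alpha l_i i / l + O(l^-2).  A path with f
    flat steps has mean weight O(l^(p - alpha f)).  A level with a single flat
    step contributes E[d] = 0, so 1 <= f <= 2 leaves only two flat steps at the
    same level, where the mean weight divided by l^(p - 2 alpha) tends to
    sigma^2 M(g).  As u <= 2 alpha, the case f >= 3 is negligible
    (path_expansion).  Summing over paths, the l-th mean weight a_l satisfies
    a_l / l^p = C0 + C1 l^-u + o(l^-u) (top_walks_expansion).

    It remains to sum over l.  Comparing the sum of the a_l with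
    C0 n^(p+1) / (p+1) by the Stolz-Cesaro theorem with denominators n^(p+1-u)
    gives
      n^-(p+1) sum_(l <= n) a_l = C0 / (p+1)
        + (C1 + [u = 1] C0 p / 2) / (p+1-u) n^-u + o(n^-u),
    where C0 p / 2 is the Euler-Maclaurin correction (mean_power_expansion).
    The five cases of the theorem are the values of this constant; for odd k
    there is no closed path with 0 or 2 flat steps, by parity. *)

Set Implicit Arguments.
Unset Strict Implicit.
Unset Printing Implicit Defensive.
Import Order.TTheory GRing.Theory Num.Theory.
Import numFieldNormedType.Exports.
Local Open Scope classical_set_scope.
Local Open Scope ring_scope.

(** * Moments and mutual independence *)

Section Moments.
Context (R : realType) (disp : measure_display) (T : measurableType disp).
Variable P : probability T R.
Implicit Types f g h : T -> R.

(** The notion finite_moments for plain functions: products and truncations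
    of random variables, which are not bundled, must qualify too. *)
Definition has_moments f :=
  forall k : nat, P.-integrable setT (EFin \o (fun w => f w ^+ k)).

Lemma has_moments_integrable f : has_moments f ->
  P.-integrable setT (EFin \o f).
Proof. by move=> /(_ 1%N). Qed.

Lemma has_moments_measurable f : has_moments f -> measurable_fun setT f.
Proof.
by move=> /has_moments_integrable /(measurable_int P) /measurable_EFinP.
Qed.

Lemma le_has_moments f g : measurable_fun setT g ->
  (forall w, `|g w| <= `|f w|) -> has_moments f -> has_moments g.
Proof.
move=> mg gf mf k; apply: le_integrable (mf k) => //.
  by apply/measurable_EFinP/measurable_funX.
by move=> w _ /=; rewrite lee_fin !normrX lerXn2r ?nnegrE.
Qed.

Lemma has_moments_cst (c : R) : has_moments (fun=> c).
Proof. by move=> k; exact: finite_measure_integrable_cst. Qed.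

(** By |x y| <= (x^2 + y^2) / 2 the k-th moment of a product is controlled by
    the moments of order 2 k of its factors, whether independent or not. *)
Lemma has_momentsM f g : has_moments f -> has_moments g ->
  has_moments (fun w => f w * g w).
Proof.
move=> mf mg k.
have ifg : P.-integrable setT
    (EFin \o (fun w => (f w ^+ (2 * k) + g w ^+ (2 * k))%R)).
  by have := integrableD measurableT (mf (2 * k)%N) (mg (2 * k)%N).
apply: le_integrable ifg => //.
  apply/measurable_EFinP/measurable_funX/measurable_funM;
    exact: has_moments_measurable.
move=> w _ /=; rewrite lee_fin exprMn mulnC !exprM normrM.
set x := f w ^+ k; set y := g w ^+ k.
rewrite [leRHS]ger0_norm ?addr_ge0 ?sqr_ge0// -[x ^+ 2]real_normK ?num_real//.
rewrite -[y ^+ 2]real_normK ?num_real//.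
by have := sqr_ge0 (`|x| - `|y|); nra.
Qed.

Lemma has_momentsX f n : has_moments f -> has_moments (fun w => f w ^+ n).
Proof. by move=> mf k; under eq_fun do rewrite -exprM; exact: mf. Qed.

Lemma has_moments_prod (I : Type) (s : seq I) (F : I -> T -> R) :
  (forall i, has_moments (F i)) -> has_moments (fun w => \prod_(i <- s) F i w).
Proof.
move=> mF; elim: s => [|i s IHs].
  by under eq_fun do rewrite big_nil; exact: has_moments_cst.
by under eq_fun do rewrite big_cons; exact: has_momentsM.
Qed.

Lemma Rintegral_sum (I : Type) (s : seq I) (F : I -> T -> R) :
  (forall i, P.-integrable setT (EFin \o F i)) ->
  \int[P]_w (\sum_(i <- s) F i w) = \sum_(i <- s) \int[P]_w F i w.
Proof.
move=> iF; elim: s => [|i s IHs].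
  under eq_Rintegral do rewrite big_nil.
  by rewrite Rintegral_cst// mul0r big_nil.
under eq_Rintegral do rewrite big_cons.
rewrite RintegralD//; first by rewrite IHs big_cons.
have -> : EFin \o (fun w => \sum_(j <- s) F j w) =
    (fun w => \sum_(j <- s) (EFin \o F j) w)%E.
  by apply/funext => w /=; rewrite sumEFin.
exact: integrable_sum.
Qed.

End Moments.

Section Independence.
Import HBNNSimple.
Context (R : realType) (disp : measure_display) (T : measurableType disp).
Variable P : probability T R.

(** The three lemmas product_rule_sfun, product_rule_ge0 and
    product_rule_extend carry the rule E[f(X) H] = E[f(X)] E[H] from
    indicator functions f to simple functions by linearity, to nonnegative
    functions by dominated convergence, and to all functions by splitting into
    positive and negative parts.  The function H is signed and fixed, which is
    what the induction in expectation_prod_mixed needs. *)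
Lemma product_rule_sfun (X : {RV P >-> R}) (H : T -> R) (g : {nnsfun R >-> R}) :
  has_moments P H ->
  (forall B : set R, measurable B ->
    \int[P]_w (\1_B (X w) * H w) = \int[P]_w \1_B (X w) * \int[P]_w H w) ->
  \int[P]_w (g (X w) * H w) = \int[P]_w g (X w) * \int[P]_w H w.
Proof.
move=> mH ruleB.
have mI (B : set R) : measurable B -> has_moments P (fun w => \1_B (X w)).
  move=> mB; apply: le_has_moments (has_moments_cst P 1) => [|w].
    by apply: measurableT_comp => //; exact: measurable_indic.
  by rewrite indicE; case: (_ \in _) => /=; rewrite ?normr0 ?normr1.
have mg (y : R) : measurable (g @^-1` [set y] : set R).
  by rewrite -[X in measurable X]setTI; exact: (measurable_funP g).
set s := fset_set (range g).
under eq_Rintegral do rewrite fimfunEord mulr_suml.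
under [in RHS]eq_Rintegral do rewrite fimfunEord.
have ii y : P.-integrable setT
   (EFin \o (fun w => y * \1_(g @^-1` [set y]) (X w) * H w)).
  apply: has_moments_integrable; apply: has_momentsM => //.
  by apply: has_momentsM; [exact: has_moments_cst | exact: (mI _ (mg _))].
rewrite Rintegral_sum; last by move=> i; exact: ii.
rewrite Rintegral_sum; last first.
  move=> i; apply: has_moments_integrable; apply: has_momentsM;
    [exact: has_moments_cst | exact: (mI _ (mg _))].
rewrite mulr_suml; apply: eq_bigr => i _.
under eq_Rintegral do rewrite -mulrA.
rewrite RintegralZl//; last first.
  by apply: has_moments_integrable; apply: has_momentsM => //; exact: mI.
rewrite ruleB// RintegralZl ?mulrA//.
by apply: has_moments_integrable; exact: mI.
Qed.

Lemma dominated_Rintegral (u : nat -> T -> R) (f g : T -> R) :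
  (forall n, measurable_fun setT (u n)) ->
  (forall w, u ^~ w @ \oo --> f w) ->
  P.-integrable setT (EFin \o g) -> (forall n w, `|u n w| <= g w) ->
  \int[P]_w u n w @[n --> \oo] --> \int[P]_w f w.
Proof.
move=> mu uf ig ug.
have mf : measurable_fun setT f.
  by apply: (@measurable_fun_cvg _ _ _ setT u) => // w _; exact: uf.
have [|||||intf _] := @dominated_convergence _ T R P setT measurableT
  (fun n => EFin \o u n) (EFin \o f) (EFin \o g).
- by move=> n; exact/measurable_EFinP.
- exact/measurable_EFinP.
- by apply: aeW => w _; apply/fine_cvgP; split; [exact: nearW|exact: uf].
- exact: ig.
- by apply: aeW => w n _ /=; rewrite lee_fin.
rewrite -[X in _ --> X]fineK; last exact: integrable_fin_num.
by move=> /fine_cvgP[_].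
Qed.

Lemma product_rule_ge0 (X : {RV P >-> R}) (H : T -> R) (f : R -> R) :
  has_moments P H -> measurable_fun setT f -> (forall x, 0 <= f x) ->
  has_moments P (f \o X) ->
  (forall B : set R, measurable B ->
    \int[P]_w (\1_B (X w) * H w) = \int[P]_w \1_B (X w) * \int[P]_w H w) ->
  \int[P]_w (f (X w) * H w) = \int[P]_w f (X w) * \int[P]_w H w.
Proof.
move=> mH mf f0 mfX ruleB.
have mf' : measurable_fun setT (EFin \o f) by exact/measurable_EFinP.
pose g := nnsfun_approx (@measurableT _ R) mf'.
have gf x : g ^~ x @ \oo --> f x.
  have := @cvg_nnsfun_approx _ _ _ _ measurableT _ mf' (fun x _ => f0 x) x I.
  by move=> /fine_cvgP[_].
have gle n x : g n x <= f x.
  rewrite -lee_fin /g nnsfun_approxE.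
  by apply: (@le_approx _ _ _ setT (EFin \o f)) => // y _; rewrite lee_fin f0.
have mg n : measurable_fun setT (fun w => g n (X w)).
  by apply: measurableT_comp => //; exact: measurable_funP.
have gfX n w : `|g n (X w)| <= f (X w) by rewrite ger0_norm.
have cvg1 : \int[P]_w g n (X w) @[n --> \oo] --> \int[P]_w f (X w).
  apply: (@dominated_Rintegral (fun n w => g n (X w)) (f \o X) (f \o X)) => //.
  exact: has_moments_integrable.
have cvg2 : \int[P]_w (g n (X w) * H w) @[n --> \oo] -->
    \int[P]_w (f (X w) * H w).
  apply: (@dominated_Rintegral (fun n w => g n (X w) * H w) _
    (fun w => `|f (X w) * H w|)) => //.
  - by move=> n; apply: measurable_funM => //; exact: has_moments_measurable mH.
  - by move=> w; apply: cvgMl.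
  - apply: integrable_norm; apply: has_moments_integrable.
    exact: (has_momentsM mfX).
  - move=> n w; rewrite !normrM ler_wpM2r//.
    by rewrite (le_trans (gfX _ _)) ?ler_norm.
have cvg3 : \int[P]_w (g n (X w) * H w) @[n --> \oo] -->
    \int[P]_w f (X w) * \int[P]_w H w.
  rewrite (_ : (fun _ => _) =
    (fun n => \int[P]_w g n (X w) * \int[P]_w H w)); first exact: cvgMl.
  by apply/funext => n; exact: (product_rule_sfun (g n) mH ruleB).
exact: (cvg_unique _ cvg2 cvg3).
Qed.

Lemma product_rule_extend (X : {RV P >-> R}) (H : T -> R) (f : R -> R) :
  has_moments P H -> measurable_fun setT f -> has_moments P (f \o X) ->
  (forall B : set R, measurable B ->
    \int[P]_w (\1_B (X w) * H w) = \int[P]_w \1_B (X w) * \int[P]_w H w) ->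
  \int[P]_w (f (X w) * H w) = \int[P]_w f (X w) * \int[P]_w H w.
Proof.
move=> mH mf mfX ruleB.
have mp : has_moments P (f^\+ \o X).
  apply: le_has_moments mfX.
    apply: measurableT_comp => //; exact: measurable_funrpos.
  move=> w /=; rewrite ger0_norm ?funrpos_ge0//.
  by rewrite /funrpos ge_max ler_norm normr_ge0.
have mn : has_moments P (f^\- \o X).
  apply: le_has_moments mfX.
    apply: measurableT_comp => //; exact: measurable_funrneg.
  move=> w /=; rewrite ger0_norm ?funrneg_ge0//.
  by rewrite /funrneg ge_max -normrN ler_norm normr_ge0.
have fE w : f (X w) = f^\+ (X w) - f^\- (X w).
  by rewrite -[in LHS](funrposBneg f).
under eq_Rintegral do rewrite fE mulrBl.
under [in RHS]eq_Rintegral do rewrite fE.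
rewrite !RintegralB//; try exact: has_moments_integrable.
- rewrite mulrBl !product_rule_ge0//.
  + exact: measurable_funrneg.
  + exact: measurable_funrpos.
- by apply: has_moments_integrable; exact: (has_momentsM mp).
- by apply: has_moments_integrable; exact: (has_momentsM mn).
Qed.

Lemma prod_indicators (I : choiceType) (X : I -> {RV P >-> R})
    (B : I -> set R) (s : seq I) : mutually_independent X ->
  uniq s -> (forall i, measurable (B i)) ->
  \int[P]_w (\prod_(i <- s) \1_(B i) (X i w)) =
  \prod_(i <- s) \int[P]_w \1_(B i) (X i w).
Proof.
move=> indX us mB.
have mXB i : measurable (X i @^-1` B i).
  rewrite -[X in measurable X]setTI.
  exact: (measurable_funP (X i) measurableT _ (mB i)).
have E i : \int[P]_w \1_(B i) (X i w) = fine (P (X i @^-1` B i)).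
  rewrite /Rintegral -(setIT (X i @^-1` B i)) -integral_indic//.
have -> : (fun w => \prod_(i <- s) \1_(B i) (X i w)) =
    \1_(\bigcap_(i in [set` s]) (X i @^-1` B i)) :> (T -> R).
  apply/funext => w; rewrite indicE.
  case: (pselect ((\bigcap_(i in [set` s]) (X i @^-1` B i)) w)); last first.
    move=> h; rewrite memNset//.
    have [i si iB] : exists2 i, i \in s & ~ B i (X i w).
      by apply: contrapT => h'; apply: h => i /= si; apply: contrapT => h2;
         apply: h'; exists i.
    by rewrite (big_rem i)//= indicE memNset// mul0r.
  move=> h; rewrite mem_set// big_seq big1// => i /h Bi.
  by rewrite indicE mem_set.
under eq_bigr do rewrite E.
rewrite /Rintegral integral_indic//; last first.
  by apply: fin_bigcap_measurable => // i _; exact: mXB.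
rewrite setIT.
transitivity (fine (\prod_(i <- s) P (X i @^-1` B i))%E).
  by congr fine; exact: indX.
elim: s {us} => [|i s IH]; first by rewrite !big_nil.
rewrite !big_cons fineM ?IH//; first by by apply: (fin_num_measure P _ (mXB _)).
apply: (big_ind (fun x : \bar R => x \is a fin_num)) => //.
  exact: fin_numM.
by move=> j _; apply: fin_num_measure.
Qed.

(** The factors indexed by s1 are arbitrary and those indexed by s2 are
    indicators.  The induction on s1 moves its head i to s2: with an indicator
    in place of f i the induction hypothesis applies, and this is the premise
    of product_rule_extend with H the product of the remaining factors. *)
Lemma expectation_prod_mixed (I : choiceType) (X : I -> {RV P >-> R})
    (f : I -> R -> R) (B : I -> set R) (s1 s2 : seq I) :
  mutually_independent X -> uniq (s1 ++ s2) ->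
  (forall i, measurable_fun setT (f i)) ->
  (forall i, has_moments P (f i \o X i)) -> (forall i, measurable (B i)) ->
  \int[P]_w (\prod_(i <- s1) f i (X i w) * \prod_(i <- s2) \1_(B i) (X i w)) =
  \prod_(i <- s1) \int[P]_w f i (X i w) *
    \prod_(i <- s2) \int[P]_w \1_(B i) (X i w).
Proof.
move=> indX us mf mfX.
have mI (D : set R) i : measurable D -> has_moments P (fun w => \1_D (X i w)).
  move=> mD; apply: le_has_moments (has_moments_cst P 1) => [|w].
    by apply: measurableT_comp => //; exact: measurable_indic.
  by rewrite indicE; case: (_ \in _) => /=; rewrite ?normr0 ?normr1.
elim: s1 s2 B us => [|i s1 IH] s2 B us mB.
  rewrite big_nil mul1r -prod_indicators//.
  by apply: eq_Rintegral => w _; rewrite big_nil mul1r.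
pose H w := \prod_(i <- s1) f i (X i w) * \prod_(i <- s2) \1_(B i) (X i w).
have mH : has_moments P H.
  apply: has_momentsM; apply: has_moments_prod => j; first exact: mfX.
  exact: mI.
move: us; rewrite /= => /andP[]; rewrite mem_cat negb_or => /andP[is1 is2] us.
have HE : \int[P]_w H w = \prod_(i <- s1) \int[P]_w f i (X i w) *
    \prod_(i <- s2) \int[P]_w \1_(B i) (X i w) by exact: IH.
under eq_Rintegral do rewrite big_cons -mulrA.
rewrite (@product_rule_extend (X i) H (f i))//.
  by rewrite HE big_cons mulrA.
move=> D mD.
pose B' j := if j == i then D else B j.
have B'E (F : R -> R) (G : I -> set R -> R) :
    \prod_(j <- s2) G j (B' j) = \prod_(j <- s2) G j (B j).
  rewrite big_seq [RHS]big_seq; apply: eq_bigr => j js2; rewrite /B'.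
  by case: eqP => // ji; rewrite -ji js2 in is2.
have := IH (i :: s2) B'; rewrite -cat_rcons -cats1 -catA.
rewrite -(cat1s i) uniq_catCA /= mem_cat negb_or is1 is2 us => /(_ isT).
have mB' j : measurable (B' j) by rewrite /B'; case: ifP.
move=> /(_ mB').
rewrite !big_cons (B'E id (fun j D => \int[P]_w \1_D (X j w))).
rewrite {2}/B' eqxx mulrCA -HE => <-.
apply: eq_Rintegral => w _; rewrite big_cons {1}/B' eqxx mulrCA /H.
by rewrite (B'E id (fun j D => \1_D (X j w))).
Qed.

Lemma independent_expectation_prod (I : choiceType) (X : I -> {RV P >-> R})
    (f : I -> R -> R) (s : seq I) :
  mutually_independent X -> uniq s ->
  (forall i, measurable_fun setT (f i)) ->
  (forall i, has_moments P (f i \o X i)) ->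
  \int[P]_w (\prod_(i <- s) f i (X i w)) =
  \prod_(i <- s) \int[P]_w f i (X i w).
Proof.
move=> indX us mf mfX.
have := @expectation_prod_mixed I X f (fun=> setT) s [::] indX.
rewrite cats0 big_nil mulr1 => <- //.
by apply: eq_Rintegral => w _; rewrite big_nil mulr1.
Qed.

Lemma mutually_independent_inj (I J : choiceType) (X : I -> {RV P >-> R})
    (h : J -> I) : injective h -> mutually_independent X ->
  mutually_independent (X \o h).
Proof.
move=> hinj indX s B us mB.
pose B' i := if pselect (exists j, h j = i) is left e
             then B (sval (cid e)) else setT.
have B'E j : B' (h j) = B j.
  rewrite /B'; case: pselect => [e|[]]; last by exists j.
  by case: cid => j' /= /hinj ->.
have mB' i : measurable (B' i) by rewrite /B'; case: pselect.
have := indX (map h s) B'; rewrite map_inj_uniq// => /(_ us mB').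
rewrite big_map; under eq_bigr do rewrite B'E; move=> <-; congr (P _).
apply/seteqP; split => [w Hw i /= /mapP[j js ->]|w Hw j /= js].
  by rewrite B'E; exact: (Hw j).
by rewrite -B'E; apply: (Hw (h j)); exact: map_f.
Qed.

End Independence.

(** * Traces of powers as sums over walks and paths *)

Definition walk_weight (R : comNzRingType) (n k : nat) (A : 'M[R]_n)
    (w : k.+1.-tuple 'I_n) : R :=
  \prod_(u < k) A (tnth w (widen_ord (leqnSn k) u)) (tnth w (lift ord0 u)).

Definition closed_walk (n k : nat) (w : k.+1.-tuple 'I_n) : bool :=
  tnth w ord0 == tnth w ord_max.

(** Splits off the first vertex of a walk. *)
Lemma big_cons_tuple (R : Type) (idx : R) (op : Monoid.com_law idx)
    (T : finType) (k : nat) (Q : pred (k.+1.-tuple T))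
    (F : k.+1.-tuple T -> R) :
  \big[op/idx]_(w | Q w) F w =
  \big[op/idx]_(p : T * k.-tuple T | Q [tuple of p.1 :: p.2])
     F [tuple of p.1 :: p.2].
Proof.
rewrite (reindex (fun p : T * k.-tuple T => [tuple of p.1 :: p.2]))//.
apply: onW_bij; exists (fun w => (thead w, [tuple of behead w])) => [[x t]|w].
  by rewrite /= theadE; congr pair; exact: val_inj.
by rewrite [RHS]tuple_eta.
Qed.

Lemma expmx_walks (R : comNzRingType) (n k : nat) (A : 'M[R]_n) i j :
  (A ^+ k) i j = \sum_(w : k.+1.-tuple 'I_n |
    (tnth w ord0 == i) && (tnth w ord_max == j)) walk_weight A w.
Proof.
elim: k i j => [|k IH] i j.
  rewrite expr0 mxE big_cons_tuple /=.
  rewrite (eq_bigl (fun p : 'I_n * 0.-tuple 'I_n => (p.1 == i) && (i == j)));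
    last first.
    move=> [x t] /=; rewrite !(tnth_nth x) [t]tuple0 /=.
    by case: eqP => // ->.
  have [_|_] := eqVneq i j; last by rewrite big_pred0// => p; rewrite andbF.
  rewrite (big_pred1 (i, [tuple])).
    by rewrite /walk_weight big_ord0.
  by move=> [x t] /=; rewrite andbT [t]tuple0 xpair_eqE
    (eqxx ([tuple] : 0.-tuple 'I_n)) andbT.
rewrite exprS mxE.
under eq_bigr => x _ do rewrite IH mulr_sumr.
rewrite big_cons_tuple
  (eq_bigl (fun p : 'I_n * k.+1.-tuple 'I_n =>
    (p.1 == i) && (tnth p.2 ord_max == j))) => [|[x t]]; last first.
  by rewrite /= !(tnth_nth x).
rewrite -(pair_big_dep (fun x => x == i)
  (fun x (t : k.+1.-tuple 'I_n) => tnth t ord_max == j)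
  (fun x t => walk_weight A [tuple of x :: t]))/= big_pred1_eq.
rewrite [RHS](partition_big
  (fun t : k.+1.-tuple 'I_n => tnth t ord0) xpredT)//=.
apply: eq_bigr => x _.
apply: eq_big => [t|t /andP[/eqP t0 _]]; first by rewrite andbC.
rewrite /walk_weight big_ord_recl; congr (A _ _ * _).
- by rewrite -t0 !(tnth_nth x).
- apply: eq_bigr => u _; congr (A _ _); by rewrite !(tnth_nth x).
Qed.

Lemma trace_expmx_walks (R : comNzRingType) (n k : nat) (A : 'M[R]_n) :
  \tr (A ^+ k) = \sum_(w : k.+1.-tuple 'I_n | closed_walk w) walk_weight A w.
Proof.
rewrite /mxtrace [RHS](partition_big (fun w => tnth w ord0) xpredT)//=.
apply: eq_bigr => i _; rewrite expmx_walks; apply: eq_bigl => w.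
by rewrite /closed_walk; case: (tnth w ord0 =P i) => [->|];
  rewrite ?andbT ?andbF// eq_sym.
Qed.

(** The matrix has size n.+1 here: these are the walks of that matrix that are
    not walks of the submatrix obtained by deleting row and column 0, which is
    the matrix of size n. *)
Definition top_walks_weight (R : comNzRingType) (d b : nat -> R)
    (n k : nat) : R :=
  \sum_(w : k.+1.-tuple 'I_n.+1 | closed_walk w && (ord0 \in w))
    walk_weight (tridiag d b n.+1) w.

Lemma tuple_lift (n k : nat) (w : k.-tuple 'I_n.+1) : ord0 \notin w ->
  exists t : k.-tuple 'I_n, w = [tuple of map (lift ord0) t].
Proof.
move=> w0.
have /fin_all_exists[t tE] : forall u, exists x : 'I_n, tnth w u = lift ord0 x.
  move=> u; have := mem_tnth u w; case: (unliftP ord0 (tnth w u)) => [x ->|->].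
    by exists x.
  by rewrite (negPf w0).
exists [tuple t u | u < k]; apply: eq_from_tnth => u.
by rewrite tE tnth_map tnth_mktuple.
Qed.

Lemma trace_tridiag_recr (R : comNzRingType) (d b : nat -> R) (n k : nat) :
  \tr (tridiag d b n.+1 ^+ k) =
  \tr (tridiag d b n ^+ k) + top_walks_weight d b n k.
Proof.
rewrite !trace_expmx_walks (bigID (fun w => ord0 \in w))/= addrC; congr (_ + _).
pose h (t : k.+1.-tuple 'I_n) := [tuple of map (lift ord0) t].
have hinj : injective h.
  move=> s t /(congr1 val) /= /inj_map st; apply: val_inj; apply: st.
  exact: lift_inj.
rewrite -big_set /=.
rewrite (_ : [set w | _ & _]%SET =
  h @: [set t : k.+1.-tuple 'I_n | closed_walk t]%SET); last first.
  apply/setP => w; rewrite inE.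
  apply/idP/imsetP => [/andP[cw /tuple_lift[t tE]]|].
    exists t => //; rewrite inE; move: cw; rewrite tE /closed_walk !tnth_map.
    by rewrite (inj_eq (@lift_inj _ _)).
  move=> [t]; rewrite inE => ct ->; apply/andP; split.
    by rewrite /closed_walk !tnth_map (inj_eq (@lift_inj _ _)).
  by apply/negP => /mapP[x _] /eqP; rewrite (negPf (neq_lift _ _)).
rewrite big_imset/=; last by move=> s t _ _; exact: hinj.
rewrite big_set; apply: eq_bigr => t _; apply: eq_bigr => u _.
by rewrite !tnth_map !mxE (inj_eq (@lift_inj _ _)) !lift0 !subSS !eqSS.
Qed.

Lemma trace_tridiag_sum (R : comNzRingType) (d b : nat -> R) (n k : nat) :
  \tr (tridiag d b n ^+ k) = \sum_(l < n) top_walks_weight d b l k.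
Proof.
elim: n => [|n IH]; first by rewrite /mxtrace !big_ord0.
by rewrite big_ord_recr /= -IH trace_tridiag_recr.
Qed.

Definition flats (k : nat) (g : k.+1.-tuple int) (i : int) : nat :=
  #|[set u in flat_steps g | g`_u == i]%SET|.

(** The paths underlying the walks through row 0, whether or not they have flat
    steps. *)
Definition top_paths (k : nat) : set (k.+1.-tuple int) :=
  [set g | is_path g /\ path_max g = 0].
Arguments top_paths k : clear implicits.

Lemma path_max0P (k : nat) (g : k.+1.-tuple int) :
  path_max g = 0 <->
    (forall u : 'I_k.+1, g`_u <= 0) /\ (exists u : 'I_k.+1, g`_u = 0).
Proof.
have g0 : g`_(@ord0 k) = g`_0 by [].
have leb (u : 'I_k.+1) : g`_u <= path_max g.
  exact: (@le_bigmax _ _ _ _ (fun u : 'I_k.+1 => g`_u) u).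
split.
  move=> gm; split => [u|]; first by have := leb u; rewrite gm.
  suff : exists u : 'I_k.+1, g`_u = path_max g by rewrite gm.
  rewrite /path_max.
  apply: (big_ind (fun x => exists u : 'I_k.+1, g`_u = x)).
  - by exists ord0.
  - by move=> x y; rewrite maxEle; case: ifP.
  - by move=> u _; exists u.
move=> [gle [u gu]].
apply/eqP; rewrite eq_le; apply/andP; split; last by rewrite -[leLHS]gu.
by apply: bigmax_le => [|v _]; [rewrite -g0|].
Qed.

(** This makes every path with maximum 0 stay between the levels -k and 0, so
    that there are finitely many of them and they fit in any matrix of size
    larger than k. *)
Lemma path_step_bound (k : nat) (g : k.+1.-tuple int) (u v : 'I_k.+1) :
  is_path g -> `|g`_u - g`_v| <= k%:Z.
Proof.
move=> [_ gs].
have H (a m : nat) : (a + m <= k)%N -> `|g`_(a + m) - g`_a| <= m%:Z.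
  elim: m => [|m IH] am; first by rewrite addn0 subrr.
  have amk : (a + m < k)%N by lia.
  have := IH (ltnW amk); have := gs (Ordinal amk) => /=.
  rewrite addnS; lia.
have vk := ltn_ord v; have uk := ltn_ord u.
have [uv|uv] := leqP u v.
  have := H u (v - u)%N; rewrite subnKC// => /(_ ltac:(lia)); lia.
have := H v (u - v)%N; rewrite subnKC ?(ltnW uv)// => /(_ ltac:(lia)); lia.
Qed.

Lemma top_path_range (k : nat) (g : k.+1.-tuple int) (u : 'I_k.+1) :
  top_paths k g -> - k%:Z <= g`_u <= 0.
Proof.
move=> [pg /path_max0P[gle [v gv]]]; rewrite gle andbT.
by have := path_step_bound u v pg; lia.
Qed.

(** Row i lies at depth i below the top level 0. *)
Definition walk_path (n k : nat) (w : k.+1.-tuple 'I_n) : k.+1.-tuple int :=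
  [tuple - (tnth w u : nat)%:Z | u < k.+1].

Lemma nth_walk_path (n k : nat) (w : k.+1.-tuple 'I_n) (u : 'I_k.+1) :
  (walk_path w)`_u = - (tnth w u : nat)%:Z.
Proof. by rewrite -tnth_nth tnth_mktuple. Qed.

Lemma walk_path_inj (n k : nat) : injective (@walk_path n k).
Proof.
move=> s t st; apply: eq_from_tnth => u; apply: val_inj.
by have := congr1 (fun g : k.+1.-tuple int => g`_u) st;
   rewrite /= !nth_walk_path => /oppr_inj[].
Qed.

Lemma walk_path_bij (n k : nat) : (k <= n)%N ->
  set_bij [set w : k.+1.-tuple 'I_n.+1 | [/\ closed_walk w, ord0 \in w &
     is_path (walk_path w)]] (top_paths k) (@walk_path n.+1 k).
Proof.
move=> kn; split.
- move=> w /= [_ w0 pw]; split => //; apply/path_max0P; split => [u|].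
    by rewrite nth_walk_path; lia.
  move/tnthP: w0 => [u wu]; exists u; rewrite nth_walk_path -wu //.
- by move=> s t _ _; exact: walk_path_inj.
- move=> g pg.
  have gk (u : 'I_k.+1) : (absz (g`_u)%R < n.+1)%N.
    by have := top_path_range u pg; lia.
  pose w := [tuple Ordinal (gk u) | u < k.+1].
  have wg : walk_path w = g.
    apply: eq_from_tnth => u; rewrite !(tnth_nth 0).
    rewrite nth_walk_path tnth_mktuple /=.
    have /andP[_] := top_path_range u pg; move: (g`_u) => x; lia.
  case: (pg) => [[g0 gs] /path_max0P[_ [v gv]]].
  exists w => //; split; last by rewrite wg.
    apply/eqP/val_inj; rewrite !tnth_mktuple /=.
    by congr absz.
  apply/tnthP; exists v; apply: val_inj; by rewrite tnth_mktuple /= gv.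
Qed.

Lemma finite_top_paths (k : nat) : finite_set (top_paths k).
Proof.
rewrite -(surj_image_eq (set_bij_sub (walk_path_bij (leqnn k)))
  (set_bij_surj (walk_path_bij (leqnn k)))).
by apply: finite_image; exact: finite_finset.
Qed.

(** A closed path takes an even number of steps that change the parity of the
    level. *)
Lemma odd_flat_steps (k : nat) (g : k.+1.-tuple int) : is_path g ->
  odd #|flat_steps g| = odd k.
Proof.
move=> [g0 gs].
have H m : (m <= k)%N ->
    odd (absz (g`_m - g`_0)%R) = odd (\sum_(u < m) (g`_u != g`_u.+1)%R).
  elim: m => [|m IH] mk; first by rewrite subrr big_ord0.
  rewrite big_ord_recr /= oddD -IH 1?ltnW//.
  have /= := gs (Ordinal mk); case: eqP => [->|]; first by rewrite addbF.
  by move: (g`_m) (g`_m.+1) (g`_0) => x y z; lia.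
have := H k (leqnn _); rewrite g0 subrr => /esym/negbT.
have kE : k = (#|flat_steps g| + \sum_(u < k) (g`_u != g`_u.+1)%R)%N :> nat.
  rewrite -sum1_card big_mkcond -big_split /= -[LHS]card_ord -sum1_card.
  by apply: eq_bigr => u _; rewrite inE; case: eqP.
by rewrite [in RHS]kE oddD => /negPf ->; rewrite addbF.
Qed.

(** For a step that is not flat this identifies the crossed pair of levels: the
    step crosses -(i+1) and -i exactly when its upper end has depth i. *)
Definition step_depth (k : nat) (g : k.+1.-tuple int) (u : 'I_k) : nat :=
  absz (Num.max g`_u g`_u.+1).

Lemma card_crossings (k : nat) (g : k.+1.-tuple int) (i : nat) :
  top_paths k g ->
  crossings g (- i.+1%:Z) =
  #|[set u | (u \notin flat_steps g) && (step_depth g u == i)]%SET|.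
Proof.
move=> pg; rewrite /crossings; congr #|pred_of_set _|; apply/setP => u.
have /andP[_ gu] := top_path_range (widen_ord (leqnSn k) u) pg.
have /andP[_ gu1] := top_path_range (lift ord0 u) pg.
case: pg => -[_ /(_ u) gs] _; move: gu gu1 gs.
rewrite !inE /step_depth /= /bump /= add1n.
move: (g`_u) (g`_u.+1) => x y x0 y0 xy.
by apply/idP/idP; lia.
Qed.

(** Groups the factors of a walk by level.  In the matrix of size n + 1 an edge
    between the rows i and i + 1 carries b_(n-i) and the diagonal entry of row i
    is d_(n+1-i). *)
Lemma walk_weight_tridiag (R : comNzRingType) (d b : nat -> R) (n k : nat)
    (w : k.+1.-tuple 'I_n.+1) : top_paths k (walk_path w) ->
  walk_weight (tridiag d b n.+1) w =
  (\prod_(i < k.+1) b (n - i)%N ^+ crossings (walk_path w) (- (i.+1)%:Z)) *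
  (\prod_(i < k.+1) d (n.+1 - i)%N ^+ flats (walk_path w) (- i%:Z)).
Proof.
move=> pw; set g := walk_path w.
have gE (u : 'I_k) : (g`_u = - (tnth w (widen_ord (leqnSn k) u) : nat)%:Z) /\
    (g`_u.+1 = - (tnth w (lift ord0 u) : nat)%:Z).
  by split; [exact: (nth_walk_path w (widen_ord (leqnSn k) u)) |
             exact: (nth_walk_path w (lift ord0 u))].
have gk (u : 'I_k.+1) := top_path_range u pw.
rewrite /walk_weight (bigID (mem (flat_steps g)))/= mulrC; congr (_ * _).
  rewrite (partition_big (fun u => inord (step_depth g u) : 'I_k.+1) xpredT)//=.
  apply: eq_bigr => i _; rewrite card_crossings// -prodr_const.
  have dk u : (step_depth g u < k.+1)%N.
    have := gk (widen_ord (leqnSn k) u); have := gk (lift ord0 u).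
    rewrite /= /bump /= add1n /step_depth -/g.
    by move: (g`_u) (g`_u.+1) => x y; lia.
  apply: eq_big => [u|u].
    by rewrite inE -[in RHS](inordK (dk u)) (inj_eq val_inj).
  move=> /andP[]; rewrite inE => fu /eqP ui.
  have {}ui : step_depth g u = i by rewrite -(inordK (dk u)) ui.
  have [gu gu1] := gE u; case: (pw) => -[_ /(_ u)] + _; rewrite -/g.
  move: fu ui; rewrite /step_depth gu gu1 mxE -(inj_eq val_inj) /=.
  move: (tnth w _ : nat) (tnth w _ : nat) => y x xy xyi xy1.
  have -> : (x == y) = false by lia.
  case: ifP => [/eqP ?|?]; first by congr b; lia.
  by case: ifP => [/eqP ?|?]; [congr b; lia | lia].
rewrite (partition_big (fun u : 'I_k => inord (absz g`_u) : 'I_k.+1) xpredT)//=.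
apply: eq_bigr => i _; rewrite /flats -prodr_const.
have dk (u : 'I_k) : (absz (g`_u)%R < k.+1)%N.
  have := gk (widen_ord (leqnSn k) u); rewrite /= -/g.
  by move: (g`_u) => x; lia.
have gle (u : 'I_k) : g`_u <= 0.
  by have /andP[] := gk (widen_ord (leqnSn k) u).
apply: eq_big => [u|u].
  rewrite inE; congr (_ && _); rewrite -(inj_eq val_inj) /= inordK//.
  by have := gle u; move: (g`_u) => x; lia.
move=> /andP[]; rewrite inE => fu /eqP ui.
have {}ui : absz g`_u = i by rewrite -(inordK (dk u)) ui.
have [gu gu1] := gE u.
move: fu ui; rewrite gu gu1 mxE -(inj_eq val_inj) /=.
move: (tnth w _ : nat) (tnth w _ : nat) => y x xy xyi.
have -> : (x == y) by lia.
by congr d; lia.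
Qed.

Lemma tridiag_walk_is_path (R : comNzRingType) (d b : nat -> R) (n k : nat)
    (w : k.+1.-tuple 'I_n) : closed_walk w ->
  walk_weight (tridiag d b n) w != 0 -> is_path (walk_path w).
Proof.
move=> cw wn0; split=> [|u].
  rewrite (nth_walk_path w ord0) (nth_walk_path w ord_max).
  by rewrite (eqP (cw : _ == _)).
rewrite (nth_walk_path w (widen_ord (leqnSn k) u)).
rewrite (nth_walk_path w (lift ord0 u)).
rewrite leNgt; apply: contra wn0 => far.
rewrite /walk_weight (bigD1 u)//= mxE -(inj_eq val_inj) /=.
move: far; move: (tnth w _ : nat) (tnth w _ : nat) => y x xy.
by do 3![rewrite ifF; last by lia]; rewrite mul0r.
Qed.

Lemma top_walks_weightE (R : comNzRingType) (d b : nat -> R) (n k : nat) :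
  (k <= n)%N ->
  top_walks_weight d b n k = \sum_(g \in top_paths k)
   (\prod_(i < k.+1) b (n - i)%N ^+ crossings g (- (i.+1)%:Z)) *
   (\prod_(i < k.+1) d (n.+1 - i)%N ^+ flats g (- i%:Z)).
Proof.
move=> kn; rewrite (@reindex_fsbig _ _ _ _ _ (@walk_path n.+1 k)
  [set w | [/\ closed_walk w, ord0 \in w & is_path (walk_path w)]]
  _ _ (walk_path_bij kn)).
pose Q (w : k.+1.-tuple 'I_n.+1) :=
  [&& closed_walk w, ord0 \in w & `[< is_path (walk_path w) >]].
transitivity (\sum_(w <- enum Q) walk_weight (tridiag d b n.+1) w).
  rewrite big_enum /= /top_walks_weight [RHS]big_mkcond [LHS]big_mkcond.
  apply: eq_bigr => w _; rewrite /Q unfold_in.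
  case: (boolP (closed_walk w)) => //= cw; case: (ord0 \in w) => //=.
  case: asboolP => // np; apply/eqP; apply: contraT => wn0; case: np.
  exact: tridiag_walk_is_path wn0.
rewrite [LHS]fsbig_seq ?enum_uniq//.
have -> : [set` enum Q] = [set w : k.+1.-tuple 'I_n.+1 |
    [/\ closed_walk w, ord0 \in w & is_path (walk_path w)]].
  apply/seteqP; split => w /=; rewrite mem_enum unfold_in /Q.
    by move=> /and3P[? ? /asboolP].
  by move=> [? ? ?]; apply/and3P; split => //; exact/asboolP.
apply: eq_fsbigr => w /set_mem wP.
by apply: walk_weight_tridiag; exact: (set_bij_homo (walk_path_bij kn)).
Qed.

(** * First-order expansions and averages of power-like sequences *)

Section Expansion.
Variable R : realType.
Implicit Types (s u p q : R).

Lemma is_derive_onem_powR s (t : R) : t < 1 ->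
  is_derive t 1 (fun x : R => (1 - x) `^ s) (- (s * (1 - t) `^ (s - 1))).
Proof.
move=> t1.
have h1 : is_derive t 1 (fun x : R => 1 - x) (-1).
  by apply: is_derive_eq; rewrite add0r mul1r.
have h2 : is_derive (1 - t) 1 (fun y : R => y `^ s) (s * (1 - t) `^ (s - 1)).
  by apply: is_derive1_powR; rewrite subr_gt0.
have := @is_derive1_comp _ (fun y : R => y `^ s) (fun x : R => 1 - x) t _ _ h2 h1.
by rewrite mulrN1.
Qed.

Lemma cvg_onem_powR0 s : (1 - x : R) `^ s @[x --> 0^'+] --> (1 : R).
Proof.
have d0 := @is_derive_onem_powR s 0 ltr01.
have c0 : {for 0, continuous (fun x : R => (1 - x) `^ s)}.
  apply: differentiable_continuous; apply/derivable1_diffP; exact: ex_derive.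
apply: cvg_at_right_filter.
by have := c0; rewrite /continuous_at /prop_for subr0 powR1.
Qed.

(** This is the Taylor expansion of (1 - x) ^ s at 0 to order 1, and the next
    lemma goes to order 2.  Both come from l'Hopital's rule; the second one
    thereby reduces to the first one for the exponent s - 1. *)
Lemma onem_powR_expand1 s :
  (1 - (1 - x : R) `^ s) / x @[x --> 0^'+] --> s.
Proof.
refine (@lhopital_at_right R (fun x => 1 - (1 - x) `^ s)
  (fun x => s * (1 - x) `^ (s - 1)) id (fun=> 1) 0 1 s ltr01 _ _ _ _ _ _).
- move=> x; rewrite in_itv /= => /andP[x0 x1].
  have := is_derive_onem_powR s x1 => h.
  apply: is_derive_eq. rewrite /GRing.scale /=; ring.
- rewrite -[X in _ --> X](subrr 1).
  by apply: cvgB; [exact: cvg_cst | exact: cvg_onem_powR0].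
- exact: cvg_at_right_filter.
- by move=> x _; exact: oner_neq0.
- have h := cvgM (cvgM (cvg_cst s) (@cvg_onem_powR0 (s - 1))) (cvg_cst (1^-1 : R)).
  by rewrite mulr1 divr1 in h; exact: h.
Qed.

Lemma onem_powR_expand2 s :
  ((1 - x : R) `^ s - 1 + s * x) / x ^+ 2 @[x --> 0^'+] --> s * (s - 1) / 2.
Proof.
refine (@lhopital_at_right R (fun x => (1 - x) `^ s - 1 + s * x)
  (fun x => s - s * (1 - x) `^ (s - 1)) (fun x => x ^+ 2) (fun x => 2 * x) 0 1
  _ ltr01 _ _ _ _ _ _).
- move=> x; rewrite in_itv /= => /andP[x0 x1].
  have := is_derive_onem_powR s x1 => h.
  apply: is_derive_eq. rewrite /GRing.scale /=; ring.
- move=> x _; apply: is_derive_eq; rewrite /GRing.scale /=; ring.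
- have c0 : x @[x --> (0 : R)^'+] --> (0 : R) by exact: cvg_at_right_filter.
  have h := cvgD (cvgB (@cvg_onem_powR0 s) (cvg_cst (1 : R)))
    (cvgM (cvg_cst s) c0).
  by rewrite subrr mulr0 addr0 in h; exact: h.
- apply: cvg_at_right_filter; rewrite -[X in _ --> X](expr0n R 2).
  exact: exprn_continuous.
- by move=> x; rewrite in_itv/= => /andP[x0 _]; rewrite mulf_neq0// gt_eqF.
- have -> : (fun x => (s - s * (1 - x) `^ (s - 1)) / (2 * x)) =
    (fun x => s / 2 * ((1 - (1 - x) `^ (s - 1)) / x)).
    by apply/funext => x; rewrite invfM; ring.
  rewrite (_ : s * (s - 1) / 2 = s / 2 * (s - 1)); last by ring.
  by apply: cvgM; [exact: cvg_cst | exact: onem_powR_expand1].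
Qed.

Lemma cvg_natV_powR u : 0 < u -> (n%:R `^ u : R)^-1 @[n --> \oo] --> (0 : R).
Proof.
move=> u0; rewrite -cvg_shiftS /=.
have := powR_cvg0 u0 => /cvg_at_rightP /(_ (fun n => n.+1%:R^-1)) h.
have {}h : (n.+1%:R^-1 : R) `^ u @[n --> \oo] --> (0 : R).
  by apply: h; split => [n|]; [rewrite invr_gt0 | exact: cvg_harmonic].
apply: cvg_trans h; apply: near_eq_cvg; apply: nearW => n.
by rewrite -[in LHS]powR_inv1// -powRrM mulN1r powRN.
Qed.

(** The limit says that x n = p + q * n ^ -u + o(n ^ -u). *)
Definition expansion u (x : nat -> R) p q :=
  n%:R `^ u * (x n - p) @[n --> \oo] --> q.

Lemma near_natr_gt0 : \forall n \near \oo, 0 < (n%:R : R).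
Proof. by exists 1%N => // n /= n0; rewrite ltr0n. Qed.

Lemma expansion_cvg u (x : nat -> R) p q : 0 < u -> expansion u x p q ->
  x n @[n --> \oo] --> p.
Proof.
move=> u0 xpq.
have : (n%:R `^ u)^-1 * (n%:R `^ u * (x n - p)) + p @[n --> \oo] --> 0 * q + p.
  by apply: cvgD; [apply: cvgM => //; exact: cvg_natV_powR | exact: cvg_cst].
rewrite mul0r add0r; apply: cvg_trans; apply: near_eq_cvg.
near=> n; rewrite mulKf ?subrK// gt_eqF// powR_gt0//; near: n.
exact: near_natr_gt0.
Unshelve. all: by end_near. Qed.

Lemma expansion_cst u (c : R) : expansion u (fun=> c) c 0.
Proof.
by rewrite /expansion subrr; under eq_fun do rewrite mulr0; exact: cvg_cst.
Qed.

Lemma expansionM u (x y : nat -> R) p q p' q' : 0 < u ->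
  expansion u x p q -> expansion u y p' q' ->
  expansion u (fun n => x n * y n) (p * p') (q * p' + p * q').
Proof.
move=> u0 hx hy; have cy := expansion_cvg u0 hy.
rewrite /expansion (_ : (fun n => _) = (fun n =>
  n%:R `^ u * (x n - p) * y n + p * (n%:R `^ u * (y n - p')))); last first.
  by apply/funext => n; ring.
by apply: cvgD; apply: cvgM => //; exact: cvg_cst.
Qed.

(** Leibniz rule for the second coefficient. *)
Lemma expansion_prod u (I : eqType) (r : seq I) (x : I -> nat -> R)
    (p q : I -> R) : 0 < u -> uniq r ->
  (forall i, i \in r -> expansion u (x i) (p i) (q i)) ->
  expansion u (fun n => \prod_(i <- r) x i n) (\prod_(i <- r) p i)
    (\sum_(j <- r) q j * \prod_(i <- r | i != j) p i).
Proof.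
move=> u0; elim: r => [|a r IH] /=.
  by move=> _ _; rewrite !big_nil; under eq_fun do rewrite big_nil;
     exact: expansion_cst.
move=> /andP[ar ur] h; rewrite !big_cons.
under eq_fun do rewrite big_cons.
rewrite eqxx /=.
have -> : \prod_(i <- r | i != a) p i = \prod_(i <- r) p i.
  rewrite big_seq_cond [RHS]big_seq; apply: eq_bigl => i.
  by case: (boolP (i \in r)) => // ir; apply: contraNneq ar => <-.
have -> : \sum_(j <- r) q j * \prod_(i <- a :: r | i != j) p i =
    p a * (\sum_(j <- r) q j * \prod_(i <- r | i != j) p i).
  rewrite mulr_sumr big_seq [RHS]big_seq; apply: eq_bigr => j jr.
  by rewrite big_cons ifT; [rewrite mulrCA | apply: contraNneq ar => ->].
apply: expansionM => //; first by apply: h; rewrite mem_head.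
by apply: IH => // i ir; apply: h; rewrite inE ir orbT.
Qed.

(** An error of order 1 / n is visible at the rate u <= 1 only when u = 1.  This
    is the source of the extra terms of the case u = 1. *)
Lemma cvg_le1_powR u (c : R) (x : nat -> R) : u <= 1 ->
  n%:R * x n @[n --> \oo] --> c ->
  n%:R `^ u * x n @[n --> \oo] --> (u == 1)%:R * c.
Proof.
rewrite le_eqVlt; case: eqP => [->|_] /=.
  by move=> _; rewrite mul1r; under [X in _ -> X @ _ --> _]eq_fun do
    rewrite powRr1//.
move=> u1 h.
have : (n%:R `^ (1 - u))^-1 * (n%:R * x n) @[n --> \oo] --> 0 * c.
  by apply: cvgM => //; apply: cvg_natV_powR; rewrite subr_gt0.
apply: cvg_trans; apply: near_eq_cvg; near=> n.
have n0 : 0 < (n%:R : R) by near: n; exact: near_natr_gt0.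
rewrite powRB ?gt_eqF ?implybT// powRr1 ?ltW// invf_div mulrA mulfVK//.
by rewrite gt_eqF.
Unshelve. all: by end_near. Qed.

Lemma cvg_divn (f : R -> R) (j : nat) (l : R) : (0 < j)%N ->
  f x @[x --> 0^'+] --> l -> f (j%:R / n%:R) @[n --> \oo] --> l.
Proof.
move=> j0 fl; rewrite -cvg_shiftS /=.
move/cvg_at_rightP : fl => /(_ (fun n => j%:R / n.+1%:R)); apply; split.
  by move=> n; rewrite divr_gt0 ?ltr0n.
rewrite -[X in _ --> X](mulr0 j%:R).
by apply: cvgM; [exact: cvg_cst | exact: cvg_harmonic].
Qed.

Lemma expansion_ratio u s (j : nat) : (0 < j)%N -> u <= 1 ->
  expansion u (fun n => (1 - j%:R / n%:R) `^ s) 1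
    ((u == 1)%:R * (- (j%:R * s))).
Proof.
move=> j0 u1; apply: cvg_le1_powR => //.
have := @cvg_divn (fun x => (1 - (1 - x) `^ s) / x) j s j0 (@onem_powR_expand1 s).
move=> /(cvgM (cvg_cst (- j%:R : R))); rewrite mulNr.
apply: cvg_trans; apply: near_eq_cvg; near=> n.
have n0 : (n%:R : R) != 0 by rewrite gt_eqF//; near: n; exact: near_natr_gt0.
have j0' : (j%:R : R) != 0 by rewrite pnatr_eq0 -lt0n.
rewrite /=; field; rewrite n0 j0' //.
Unshelve. all: by end_near. Qed.

(** A bounded shift of the index does not affect the coefficients, since
    (n / (n - j)) ^ u tends to 1. *)
Lemma expansion_shift u (x : nat -> R) p q (j : nat) : 0 < u ->
  expansion u x p q ->
  expansion u (fun n => x (n - j)%N) p q.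
Proof.
move=> u0 h; case: j => [|j]; first by under eq_fun do rewrite subn0.
have : (n - j.+1)%:R `^ u * (x (n - j.+1)%N - p) @[n --> \oo] --> q.
  by rewrite (cvg_centern _ (fun n => n%:R `^ u * (x n - p))).
have := @cvg_divn (fun x => (1 - x) `^ (- u)) j.+1 1 isT (@cvg_onem_powR0 (- u)).
move=> /cvgM /[apply]; rewrite mul1r; apply: cvg_trans; apply: near_eq_cvg.
near=> n.
have nj : (j.+1 < n)%N by near: n; exact: nbhs_infty_gt.
have n0 : 0 < (n%:R : R) by rewrite ltr0n; lia.
have nj0 : 0 < ((n - j.+1)%:R : R) by rewrite ltr0n; lia.
rewrite /=; have -> : 1 - j.+1%:R / n%:R = (n - j.+1)%:R / n%:R :> R.
  by rewrite natrB 1?ltnW// mulrBl divff// gt_eqF.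
rewrite /= mulrA; congr (_ * _).
rewrite powRN powRM ?invr_ge0 ?ltW// -[in X in (_ * X)^-1]powR_inv1 ?ltW//.
rewrite -powRrM mulN1r powRN invfM invrK mulrAC mulVf ?mul1r//.
by rewrite gt_eqF// powR_gt0.
Unshelve. all: by end_near. Qed.

(** The increments of S - K D are eventually at most eps (D (n+1) - D n) in
    absolute value, so that |S - K D| is at most a constant plus eps D. *)
Lemma stolz_cesaro (S D : nat -> R) (K : R) :
  (forall n, 0 <= D n) -> (forall n, D n < D n.+1) ->
  (D n)^-1 @[n --> \oo] --> (0 : R) ->
  (S n.+1 - S n) / (D n.+1 - D n) @[n --> \oo] --> K ->
  S n / D n @[n --> \oo] --> K.
Proof.
move=> D0 Dlt DV SDK; pose e n := S n - K * D n.
suff : e n / D n @[n --> \oo] --> (0 : R).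
  move=> eD; rewrite -[X in _ --> X]add0r.
  have : e n / D n + K @[n --> \oo] --> 0 + K by apply: cvgD => //; exact: cvg_cst.
  apply: cvg_trans; apply: near_eq_cvg; near=> n.
  have Dn : 0 < D n.
    have n0 : (0 < n)%N by near: n; exact: nbhs_infty_gt.
    by rewrite -(prednK n0) (le_lt_trans (D0 _) (Dlt _)).
  by rewrite /e; field; rewrite gt_eqF.
apply/cvgrPdist_le => eps eps0.
have /cvgrPdist_le/(_ (eps / 2) (divr_gt0 eps0 (ltr0Sn _ _)))[N _ HN] := SDK.
have step n : (N <= n)%N -> `|e n.+1 - e n| <= eps / 2 * (D n.+1 - D n).
  move=> /HN /=; have dD : 0 < D n.+1 - D n by rewrite subr_gt0.
  have -> : e n.+1 - e n =
      - (K - (S n.+1 - S n) / (D n.+1 - D n)) * (D n.+1 - D n).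
    by rewrite /e; field; rewrite gt_eqF.
  by move=> h; rewrite normrM normrN (gtr0_norm dD) ler_wpM2r// ltW.
have bound m : `|e (N + m)%N| <= `|e N| + eps / 2 * (D (N + m)%N - D N).
  elim: m => [|m IH]; first by rewrite addn0 subrr mulr0 addr0.
  have := step (N + m)%N (leq_addr _ _); rewrite addnS.
  move: IH; have := ler_normD (e (N + m).+1 - e (N + m)%N) (e (N + m)%N).
  rewrite subrK; lra.
have cN : `|e N| * (D n)^-1 @[n --> \oo] --> `|e N| * 0.
  by apply: cvgM => //; exact: cvg_cst.
rewrite mulr0 in cN.
have /cvgrPdist_le/(_ (eps / 2) (divr_gt0 eps0 (ltr0Sn _ _))) := cN.
move=> hN; near=> n.
have nN : (N < n)%N by near: n; exact: nbhs_infty_gt.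
have Dn : 0 < D n.
  have n0 : (0 < n)%N by lia.
  by rewrite -(prednK n0) (le_lt_trans (D0 _) (Dlt _)).
have h1 : `|e N| / D n <= eps / 2.
  have : `|0 - `|e N| / D n| <= eps / 2 by near: n; exact: hN.
  by rewrite sub0r normrN ger0_norm// divr_ge0// ltW.
have := bound (n - N)%N; rewrite subnKC 1?ltnW// => h2.
rewrite sub0r normrN normrM normfV (gtr0_norm Dn).
rewrite ler_pdivrMr// in h1; rewrite ler_pdivrMr//.
have := D0 N; nra.
Unshelve. all: by end_near. Qed.

End Expansion.

(** Stolz-Cesaro for S n = sum_(l <= n) a l - C0 n^s / s, where s = p + 1, with
    denominators n^q, where q = s - u.  With x = 1 / n the increment of n^q is
    n^q (1 - (1 - x)^q), which is equivalent to q n^(q-1).  The increment of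
    n^s / s is n^p (1 - p x / 2 + o(x)) by the second-order expansion, and this
    produces the term in p / 2 at the rate u = 1. *)
Lemma mean_power_expansion (R : realType) (a : nat -> R) (p u C0 C1 : R) :
  0 < p -> 0 < u -> u <= 1 ->
  expansion u (fun n => a n / n%:R `^ p) C0 C1 ->
  expansion u (fun n => (\sum_(l < n) a l.+1) / n%:R `^ (p + 1))
    (C0 / (p + 1)) ((C1 + (u == 1)%:R * (C0 * (p / 2))) / (p + 1 - u)).
Proof.
move=> p0 u0 u1 ha; pose s := p + 1; pose q := p + 1 - u.
have s0 : 0 < s by rewrite /s; lra.
have q0 : 0 < q by rewrite /q; lra.
pose D n : R := n%:R `^ q.
pose S n := \sum_(l < n) a l.+1 - C0 / s * n%:R `^ s.
have natE (n : nat) : (0 < n)%N -> (n%:R : R) `^ s = n%:R `^ p * n%:R /\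
    (n%:R : R) `^ q = n%:R `^ p * n%:R / n%:R `^ u.
  move=> n0; have nn : (n%:R : R) != 0 by rewrite pnatr_eq0 -lt0n.
  have E : (n%:R : R) `^ s = n%:R `^ p * n%:R.
    by rewrite /s powRD ?nn ?implybT// powRr1.
  by split => //; rewrite /q powRB ?nn ?implybT// -E.
have SD : S n / D n @[n --> \oo] -->
    (C1 + (u == 1)%:R * (C0 * (p / 2))) / q.
  apply: stolz_cesaro.
  - by move=> n; exact: powR_ge0.
  - by move=> n; rewrite /D gt0_ltr_powR ?nnegrE ?ltr_nat.
  - exact: cvg_natV_powR.
  pose x (n : nat) : R := 1%:R / n%:R.
  pose num n : R := n%:R `^ u * (a n / n%:R `^ p - C0) +
    n%:R `^ u * (C0 * (1 - (1 - (1 - x n) `^ s) / (x n * s))).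
  pose den n : R := (1 - (1 - x n) `^ q) / x n.
  have cden : den n @[n --> \oo] --> q.
    exact: (@cvg_divn _ (fun x => (1 - (1 - x) `^ q) / x) 1 q isT
      (@onem_powR_expand1 _ q)).
  have cnum : num n @[n --> \oo] --> C1 + (u == 1)%:R * (C0 * (p / 2)).
    apply: cvgD => //; apply: cvg_le1_powR => //.
    have := @cvg_divn _ (fun x => ((1 - x) `^ s - 1 + s * x) / x ^+ 2) 1 _ isT
      (@onem_powR_expand2 _ s).
    move=> /(cvgM (cvg_cst (C0 / s))).
    have -> : C0 / s * (s * (s - 1) / 2) = C0 * (p / 2).
      by rewrite /s; field; rewrite gt_eqF.
    apply: cvg_trans; apply: near_eq_cvg; near=> n.
    have n0 : (n%:R : R) != 0.
      by rewrite pnatr_eq0 -lt0n; near: n; exists 1%N.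
    rewrite /x /=; field; rewrite n0 gt_eqF//.
  have h : num n.+1 / den n.+1 @[n --> \oo] -->
      (C1 + (u == 1)%:R * (C0 * (p / 2))) / q.
    rewrite (cvg_shiftS (fun n => num n / den n)).
    by apply: cvgM => //; apply: cvgV => //; exact: lt0r_neq0.
  apply: cvg_trans h; apply: near_eq_cvg; apply: nearW => n.
  rewrite /num /den /S /D.
  have [Es Eq] := natE n.+1 isT.
  have xE : x n.+1 = n.+1%:R^-1 by rewrite /x div1r.
  have Mn : (n%:R : R) = n.+1%:R * (1 - x n.+1).
    by rewrite xE mulrBr mulr1 divff ?pnatr_eq0// -natr1 addrK.
  have x1 : 0 <= 1 - x n.+1.
    by rewrite xE subr_ge0 invf_le1 ?ltr0n// ler1n.
  have powE r : (n%:R : R) `^ r = n.+1%:R `^ r * (1 - x n.+1) `^ r.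
    by rewrite Mn powRM.
  rewrite big_ord_recr /= !powE Es Eq.
  have Z1 : (1 - x n.+1) `^ q < 1.
    have <- : (1 : R) `^ q = 1 by rewrite powR1.
    rewrite gt0_ltr_powR ?nnegrE ?powR1//.
    by rewrite ltrBlDr ltrDl xE invr_gt0.
  have P0 : 0 < (n.+1%:R : R) `^ p by rewrite powR_gt0.
  have A0 : 0 < (n.+1%:R : R) `^ u by rewrite powR_gt0.
  move: P0 A0 Z1; rewrite xE.
  move: ((1 - n.+1%:R^-1) `^ q) ((1 - n.+1%:R^-1) `^ s) 
    (_ `^ p) (_ `^ u) => Z Y P A P0 A0 Z1.
  have := ltr0Sn R n; move: (n.+1%:R : R) => N N0.
  by field; rewrite !gt_eqF// subr_gt0// gtr_pMr// mulr_gt0.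
rewrite /expansion -/q; apply: cvg_trans SD; apply: near_eq_cvg; near=> n.
have n0 : (0 < n)%N by near: n; exists 1%N.
have [Es Eq] := natE n n0.
have P0 : 0 < (n%:R : R) `^ p by rewrite powR_gt0 // ltr0n.
have A0 : 0 < (n%:R : R) `^ u by rewrite powR_gt0 // ltr0n.
have nn : (n%:R : R) != 0 by rewrite pnatr_eq0 -lt0n.
rewrite /S /D -/s Es Eq; field; rewrite nn !gt_eqF//.
Unshelve. all: by end_near. Qed.

(** * The expansion of the weight of one path *)

(** Turns a product or sum over all negative levels into one over the k + 1
    highest ones, beyond which no path of length k goes. *)
Lemma fsbig_levels (R : Type) (idx : R) (op : Monoid.com_law idx) (k : nat)
    (Q : set int) (F : int -> R) :
  (forall i : int, i < - k.+1%:Z -> F i = idx) ->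
  \big[op/idx]_(i \in [set i : int | i < 0 /\ Q i]) F i =
  \big[op/idx]_(i < k.+1 | `[< Q (- i.+1%:Z) >]) F (- i.+1%:Z).
Proof.
move=> Fidx.
pose h (i : 'I_k.+1) := - (i.+1)%:Z.
have hinj : injective h by move=> i j /oppr_inj [] ij; exact: val_inj.
rewrite (@fsbigE _ _ op _ _ [seq h i | i <- enum 'I_k.+1 & `[< Q (h i) >]]).
- rewrite big_map big_filter_cond big_enum_cond /=; apply: eq_bigl => i.
  case: asboolP => //= Qi; apply/idP; rewrite mem_set//=; split => //.
- by rewrite map_inj_uniq// filter_uniq// enum_uniq.
- move=> i /= /mapP[j]; rewrite mem_filter => /andP[/asboolP Qj _] ->.
  by split => //; rewrite /h; lia.
- move=> i [i0 Qi] ir; apply: Fidx; rewrite ltNge; apply: contra ir => ik.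
  have ik' : (`|i|.-1 < k.+1)%N by lia.
  have ih : i = h (Ordinal ik') by rewrite /h /=; lia.
  rewrite ih; apply: map_f; rewrite mem_filter mem_enum andbT -ih.
  exact/asboolP.
Qed.

Lemma crossings_deep (k : nat) (g : k.+1.-tuple int) (i : int) :
  top_paths k g -> i < - k.+1%:Z -> crossings g i = 0%N.
Proof.
move=> pg ik; apply/eqP; rewrite cards_eq0; apply/eqP/setP => u; rewrite !inE.
have /andP[gu _] := top_path_range (widen_ord (leqnSn k) u) pg.
have /andP[gu1 _] := top_path_range (lift ord0 u) pg.
move: gu gu1; rewrite /= /bump /= add1n; move: (g`_u) (g`_u.+1) => x y.
by lia.
Qed.

Section Levels.
Variables (R : realType) (k : nat) (g : k.+1.-tuple int).
Hypothesis pg : top_paths k g.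

Let c (i : 'I_k.+1) := crossings g (- i.+1%:Z).

Lemma MweightE (m : nat -> R) : m 0%N = 1 ->
  Mweight m g = \prod_(i < k.+1) m (c i).
Proof.
move=> m0; rewrite /Mweight.
rewrite (_ : [set i | i < 0] = [set i : int | i < 0 /\ setT i]); last first.
  by apply/seteqP; split => i //= [].
rewrite (@fsbig_levels _ _ _ k) => [|i ik]; last by rewrite crossings_deep.
by apply: eq_bigl => i; exact/asboolP.
Qed.

Lemma level_sumE :
  level_sum R g = \sum_(i < k.+1) (- i.+1%:R) * (c i)%:R.
Proof.
rewrite /level_sum.
rewrite (_ : [set i | i < 0] = [set i : int | i < 0 /\ setT i]); last first.
  by apply/seteqP; split => i //= [].
rewrite (@fsbig_levels _ _ _ k) => [|i ik]; last first.
  by rewrite crossings_deep// mulr0.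
apply: eq_big => i; first exact/asboolP.
by rewrite mulrNz.
Qed.

Lemma XiweightE (m xi : nat -> R) : m 0%N = 1 -> xi 0%N = 0 ->
  Xiweight m xi g =
  \sum_(j < k.+1) xi (c j) * \prod_(i < k.+1 | i != j) m (c i).
Proof.
move=> m0 xi0; rewrite /Xiweight.
rewrite (_ : [set i | i < 0] = [set i : int | i < 0 /\ setT i]); last first.
  by apply/seteqP; split => i //= [].
rewrite (@fsbig_levels _ _ _ k) => [|i ik]; last first.
  by rewrite crossings_deep// xi0 mul0r.
apply: eq_big => j; first exact/asboolP.
move=> _; congr (_ * _).
rewrite (@fsbig_levels _ _ _ k) => [|i ik]; last by rewrite crossings_deep.
apply: eq_bigl => i; apply/asboolP/idP => [h|].
  by apply/eqP => ij; apply: h; rewrite ij.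
by apply: contra_neq_not => /oppr_inj[] ij; exact: val_inj.
Qed.

Lemma sum_crossings_flats : (\sum_(i < k.+1) c i + #|flat_steps g| = k)%N.
Proof.
rewrite -[RHS]card_ord -(cardsC (flat_steps g)) addnC; congr (_ + _)%N.
rewrite -sum1_card (partition_big
  (fun u => inord (step_depth g u) : 'I_k.+1) xpredT)//=.
apply: eq_bigr => i _; rewrite /c card_crossings// -sum1_card.
apply: eq_bigl => u; rewrite !inE; congr (_ && _).
have dk : (step_depth g u < k.+1)%N.
  have := top_path_range (widen_ord (leqnSn k) u) pg.
  have := top_path_range (lift ord0 u) pg.
  rewrite /= /bump /= add1n /step_depth.
  by move: (g`_u) (g`_u.+1) => x y; lia.
by rewrite -[RHS](inj_eq val_inj) /= inordK.
Qed.

End Levels.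

Lemma eq_expansion (R : realType) (u : R) (x y : nat -> R) p q :
  (\forall n \near \oo, x n = y n) -> expansion u x p q -> expansion u y p q.
Proof.
move=> xy; apply: cvg_trans; apply: near_eq_cvg.
by apply: filterS xy => n ->.
Qed.

(** One edge, j levels below the reference level n.  The second coefficient
    collects the rate xi of the moments of b and, when u = 1, the first-order
    term of ((n - j) / n) ^ (alpha c). *)
Lemma level_expansion (R : realType) (alpha u : R) (m xi : nat -> R)
    (Bm : nat -> nat -> R) (c j : nat) : 0 < u -> u <= 1 ->
  (forall c, expansion u
    (fun n => Bm c n / (n%:R `^ alpha) ^+ c) (m c) (xi c)) ->
  (0 < j)%N ->
  expansion u (fun n => Bm c (n - j)%N / (n%:R `^ alpha) ^+ c) (m c)
    (xi c + m c * ((u == 1)%:R * (- (j%:R * (alpha * c%:R))))).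
Proof.
move=> u_gt0 u_le1 hB j0.
have h := expansionM u_gt0 (expansion_shift j u_gt0 (hB c))
  (@expansion_ratio _ u (alpha * c%:R) j j0 u_le1).
rewrite !mulr1 in h; apply: eq_expansion h.
near=> n.
have nj : (j < n)%N by near: n; exact: nbhs_infty_gt.
have n0 : 0 < (n%:R : R) by rewrite ltr0n; lia.
have nj0 : 0 < ((n - j)%:R : R) by rewrite ltr0n; lia.
have -> : 1 - j%:R / n%:R = (n - j)%:R / n%:R :> R.
  by rewrite natrB 1?ltnW// mulrBl divff// gt_eqF.
rewrite powRM ?invr_ge0 ?ltW// -[(n%:R)^-1]powR_inv1 ?ltW//.
rewrite -[n%:R `^ (-1) `^ _]powRrM mulN1r powRN.
rewrite !powRrM !powR_mulrn ?powR_ge0//.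
by field; rewrite !expf_neq0// gt_eqF// powR_gt0.
Unshelve. all: by end_near. Qed.

Lemma cvg_bounded_mul0 (R : realType) (x y : nat -> R) (C l : R) :
  (\forall n \near \oo, `|y n| <= C) -> x n @[n --> \oo] --> (0 : R) ->
  x n * y n @[n --> \oo] --> (0 : R).
Proof.
move=> yC x0.
have h : C * `|x n| @[n --> \oo] --> (0 : R).
  rewrite -(mulr0 C) -(@normr0 _ R).
  by apply: cvgM; [exact: cvg_cst | exact: cvg_norm].
apply: (@squeeze_cvgr _ _ _ _ (fun n => - (C * `|x n|)) (fun n => C * `|x n|)).
- apply: filterS yC => n yn; rewrite -ler_norml normrM mulrC.
  by rewrite ler_wpM2r.
- by rewrite -oppr0; exact: cvgN.
- exact: h.
Qed.

Section PathExpansion.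
Variables (R : realType) (alpha u sigma : R) (m xi : nat -> R).
(* Bm c n and Dm c n stand for the moments of order c of b_n and d_n. *)
Variables (Bm Dm : nat -> nat -> R).
Hypotheses (alpha_gt0 : 0 < alpha) (u_gt0 : 0 < u) (u_le1 : u <= 1)
  (u_le2a : u <= 2 * alpha) (m0 : m 0%N = 1) (xi0 : xi 0%N = 0).
Hypothesis hB : forall c,
  expansion u (fun n => Bm c n / (n%:R `^ alpha) ^+ c) (m c) (xi c).
Hypothesis Dm0 : forall n, Dm 0 n = 1.
Hypothesis Dm1 : forall n, (0 < n)%N -> Dm 1 n = 0.
Hypothesis Dm2 : Dm 2 n @[n --> \oo] --> sigma ^+ 2.
Hypothesis Dm_bounded : forall f, exists C : R, forall n, (0 < n)%N ->
  `|Dm f n| <= C.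

Variables (k : nat) (g : k.+1.-tuple int).
Hypothesis pg : top_paths k g.

Let c (i : 'I_k.+1) := crossings g (- i.+1%:Z).
Let f (i : 'I_k.+1) := flats g (- (i : nat)%:Z).

(** The edge factors of a path alone, normalised by the number of edge steps,
    which falls short of k by the number of flat steps. *)
Lemma edges_expansion :
  expansion u
    (fun n => (\prod_(i < k.+1) Bm (c i) (n - i.+1)%N) /
              (n%:R `^ alpha) ^+ (\sum_(i < k.+1) c i))
    (Mweight m g)
    (Xiweight m xi g + (u == 1)%:R * (alpha * (level_sum R g * Mweight m g))).
Proof.
have h := @expansion_prod _ u _ (index_enum 'I_k.+1)
  (fun i n => Bm (c i) (n - i.+1) / (n%:R `^ alpha) ^+ c i)
  (fun i => m (c i)) _ u_gt0 (index_enum_uniq _)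
  (fun i _ => @level_expansion _ _ _ _ _ _ (c i) i.+1 u_gt0 u_le1 hB isT).
rewrite MweightE// XiweightE// level_sumE//.
rewrite [X in expansion _ _ _ X](_ : _ = \sum_(j < k.+1)
  (xi (c j) + m (c j) * ((u == 1)%:R * (- (j.+1%:R * (alpha * (c j)%:R))))) *
  \prod_(i < k.+1 | i != j) m (c i)); last first.
  rewrite mulr_suml !mulr_sumr -big_split /=; apply: eq_bigr => j _.
  have -> : \prod_(i < k.+1) m (c i) =
    m (c j) * \prod_(i < k.+1 | i != j) m (c i) by rewrite (bigD1 j).
  by ring.
apply: eq_expansion h; apply: nearW => n.
by rewrite big_split /= prodfV prodrXr.
Qed.

(** With f flat steps the weight equals n^(-alpha f) times the normalised edge
    factors, which converge, times the moments of d, which are bounded.  So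
    f >= 3 is negligible at the rate u <= 2 alpha.  If f is 1, or 2 on distinct levels,
    then some level has exactly one flat step and the mean is zero; there remain
    f = 0 and Gamma2. *)
Lemma path_expansion :
  expansion u
    (fun n => (\prod_(i < k.+1) Bm (c i) (n - i.+1)%N) *
              (\prod_(i < k.+1) Dm (f i) (n - i)%N) / (n%:R `^ alpha) ^+ k)
    (if `[< Gamma k g >] then Mweight m g else 0)
    ((if `[< Gamma k g >] then
        Xiweight m xi g + (u == 1)%:R * (alpha * (level_sum R g * Mweight m g))
      else 0) +
     (if `[< Gamma2 k g >] then
        (u == 2 * alpha)%:R * sigma ^+ 2 * Mweight m g else 0)).
Proof.
have := sum_crossings_flats pg; rewrite -/c; set s := \sum_(i < k.+1) c i => sk.
case: (pg) => isp pmax.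
have pk n : (n%:R `^ alpha) ^+ k =
    (n%:R `^ alpha) ^+ s * (n%:R `^ alpha) ^+ #|flat_steps g| :> R.
  by rewrite -exprD sk.
have fle i : (f i <= #|flat_steps g|)%N.
  by apply: subset_leq_card; apply/fintype.subsetP => v; rewrite inE => /andP[].
have [nf0|nf0] := posnP #|flat_steps g|.
  have f0 i : f i = 0%N by apply/eqP; rewrite -leqn0 -nf0 fle.
  have G1 : Gamma k g by split => //; apply/eqP; rewrite -cards_eq0 nf0.
  have -> : `[< Gamma2 k g >] = false.
    by apply/asboolP => -[_ _]; rewrite nf0.
  rewrite (asboolT G1) addr0; apply: eq_expansion edges_expansion.
  apply: nearW => n; rewrite pk nf0 expr0 mulr1.
  by rewrite [X in _ * X / _]big1 ?mulr1// => i _; rewrite f0.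
have -> : `[< Gamma k g >] = false.
  by apply/asboolP => -[_ _ fl0]; rewrite fl0 cards0 in nf0.
rewrite add0r /expansion.
pose X n := (\prod_(i < k.+1) Bm (c i) (n - i.+1)%N) / (n%:R `^ alpha) ^+ s.
have cX : X n @[n --> \oo] --> Mweight m g.
  exact: expansion_cvg u_gt0 edges_expansion.
pose Y n := \prod_(i < k.+1) Dm (f i) (n - i).
pose r n : R := n%:R `^ u / (n%:R `^ alpha) ^+ #|flat_steps g|.
have E n : n%:R `^ u * ((\prod_(i < k.+1) Bm (c i) (n - i.+1)%N) * Y n /
    (n%:R `^ alpha) ^+ k - 0) = r n * X n * Y n.
  by rewrite subr0 /r /X pk invfM; ring.
under eq_fun do rewrite E.
(* A level with exactly one flat step brings the factor E[d] = 0. *)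
have one i : f i = 1%N -> r n * X n * Y n @[n --> \oo] --> (0 : R).
  move=> fi.
  have h : (fun=> 0 : R) n @[n --> \oo] --> (0 : R) by exact: cvg_cst.
  apply: cvg_trans h; apply: near_eq_cvg.
  near=> n; have ni : (i < n)%N by near: n; exists i.+1.
  by rewrite /Y (bigD1 i)//= fi Dm1 ?subn_gt0// mul0r mulr0.
have glev (v : 'I_k) : exists2 i : 'I_k.+1, g`_v = - (i : nat)%:Z &
    f i = #|[set w in flat_steps g | g`_w == g`_v]%SET|.
  have := top_path_range (widen_ord (leqnSn k) v) pg => /= vr.
  have vk : (`|(g`_v)%R| < k.+1)%N by move: vr; move: (g`_v) => x; lia.
  have gv : g`_v = - (`|(g`_v)%R|%N)%:Z by move: vr; move: (g`_v) => x; lia.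
  by exists (Ordinal vk) => //; rewrite /f /flats /= -gv.
have rc : u < alpha * #|flat_steps g|%:R -> r n @[n --> \oo] --> (0 : R).
  move=> uf; have h : (n%:R `^ (alpha * #|flat_steps g|%:R - u) : R)^-1
      @[n --> \oo] --> (0 : R) by apply: cvg_natV_powR; rewrite subr_gt0.
  apply: cvg_trans h; apply: near_eq_cvg; near=> n.
  have n0 : (n%:R : R) != 0 by rewrite pnatr_eq0 -lt0n; near: n; exists 1%N.
  rewrite /r powRB ?n0 ?implybT// invf_div powRrM powR_mulrn ?powR_ge0//.
have bY : exists C : R, \forall n \near \oo, `|Y n| <= C.
  have /fin_all_exists[C hC] := fun i : 'I_k.+1 => Dm_bounded (f i).
  exists (\prod_i C i); near=> n.
  have nk : (k < n)%N by near: n; exists k.+1.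
  rewrite normr_prod; apply: ler_prod => i _; rewrite normr_ge0 /=.
  by apply: hC; rewrite subn_gt0 (leq_ltn_trans _ nk)// -ltnS.
have small : u < alpha * #|flat_steps g|%:R ->
    r n * X n * Y n @[n --> \oo] --> (0 : R).
  move=> /rc cr; have [C hC] := bY.
  apply: (cvg_bounded_mul0 0 hC); rewrite -(mul0r (Mweight m g)).
  exact: cvgM.
case: (asboolP (Gamma2 k g)) => [G2|nG2]; last first.
  have [v vf] : exists v, v \in flat_steps g by apply/card_gt0P.
  have [nf3|] := leqP 3 #|flat_steps g|.
    apply: small; have : (3 : R) <= #|flat_steps g|%:R by rewrite ler_nat.
    by move: alpha_gt0 u_le2a; nra.
  rewrite ltnS leq_eqVlt => /orP[/eqP nf2|]; last first.
    rewrite ltnS => nf1; have {nf0} nf1 : #|flat_steps g| = 1%N by lia.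
    have [i giv fi] := glev v; apply: (one i); rewrite fi.
    have /eqP/cards1P[w flw] := nf1; move: vf; rewrite flw inE => /eqP ->.
    rewrite -(cards1 w); congr #|pred_of_set _|; apply/setP => z.
    by rewrite !inE; case: eqP => // ->; rewrite eqxx.
  have /eqP/cards2P[a [b [ab flab]]] := nf2.
  have gab : g`_a != g`_b.
    apply/eqP => gab; apply: nG2; split => // x y; rewrite flab !inE.
    by move=> /orP[] /eqP -> /orP[] /eqP ->.
  have [i gi fi] := glev a; apply: (one i); rewrite fi -(cards1 a).
  congr #|pred_of_set _|; apply/setP => z; rewrite flab !inE.
  case: (z =P a) => [->|_] /=; first by rewrite eqxx.
  by case: (z =P b) => [->|] //=; rewrite eq_sym (negPf gab).
case: (G2) => _ _ nf2 same.
move: u_le2a; rewrite le_eqVlt => /orP[/eqP ua|ua]; last first.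
  rewrite lt_eqF// !mul0r; apply: small.
  by rewrite nf2 mulrC.
have [v vf] : exists v, v \in flat_steps g by apply/card_gt0P; rewrite nf2.
have [i gi fi] := glev v.
have fi2 : f i = 2%N.
  rewrite fi -nf2; congr #|pred_of_set _|; apply/setP => w; rewrite !inE.
  by case: eqP => //= gw; apply/eqP; apply: same => //; rewrite inE; apply/eqP.
have fj j : j != i -> f j = 0%N.
  move=> ji; apply/eqP; rewrite cards_eq0; apply/eqP/setP => w; rewrite !inE.
  apply/negP => /andP[gw /eqP gwj]; move: ji; apply/negP; rewrite negbK.
  have : g`_w = g`_v by apply: same => //; rewrite inE.
  by rewrite gwj gi => /oppr_inj[] /val_inj ->.
rewrite ua eqxx mul1r mulrC.
have cY : Y n @[n --> \oo] --> sigma ^+ 2.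
  have h : Dm 2 (n - i)%N @[n --> \oo] --> sigma ^+ 2.
    by rewrite (cvg_centern i (Dm 2)).
  apply: cvg_trans h; apply: near_eq_cvg; apply: nearW => n.
  rewrite /Y (bigD1 i)//= fi2 big1 ?mulr1// => j ji.
  by rewrite fj.
apply: cvgM => //; apply: cvg_trans cX; apply: near_eq_cvg; near=> n.
have n0 : 0 < (n%:R : R) by rewrite ltr0n; near: n; exists 1%N.
rewrite /r nf2 ua mulrC [2 * _]mulrC powRrM powR_mulrn ?powR_ge0//.
by rewrite divff ?mulr1// expf_neq0// gt_eqF// powR_gt0.
Unshelve. all: by end_near. Qed.

End PathExpansion.

(** * Expectations of walk weights *)

Lemma near_cvg_EFin (R : realType) (e : nat -> \bar R) (x : nat -> R) (l : R) :
  (\forall n \near \oo, e n = (x n)%:E) ->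
  e n @[n --> \oo] --> l%:E <-> x n @[n --> \oo] --> l.
Proof.
move=> ex; split.
  move=> /fine_cvgP[_]; apply: cvg_trans; apply: near_eq_cvg.
  by apply: filterS ex => n /= ->.
move=> xl; apply/fine_cvgP; split; first by apply: filterS ex => n ->.
apply: cvg_trans xl; apply: near_eq_cvg.
by apply: filterS ex => n /= ->.
Qed.

Lemma exprZ_mx (R : comNzRingType) (n k : nat) (c : R) (A : 'M[R]_n) :
  (c *: A) ^+ k = c ^+ k *: A ^+ k.
Proof.
elim: k => [|k IH]; first by rewrite !expr0 scale1r.
rewrite !exprS IH -[LHS]/(_ *m _) -[A * _]/(A *m _).
by rewrite -scalemxAl -scalemxAr scalerA.
Qed.

Lemma ntrace_scaled (R : realType) (alpha : R) (d b : nat -> R) (n k : nat) :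
  ntrace (scaled_tridiag alpha d b n ^+ k) =
  n%:R^-1 * ((n%:R `^ (- alpha)) ^+ k * \sum_(l < n) top_walks_weight d b l k).
Proof.
by rewrite /ntrace /scaled_tridiag exprZ_mx mxtraceZ trace_tridiag_sum.
Qed.

Section RandomTridiagonal.
Context (R : realType) (disp : measure_display) (T : measurableType disp).
Variables (P : probability T R) (d b : nat -> {RV P >-> R}).
Hypothesis indep : mutually_independent (joint_family d b).
Hypothesis d_moments : forall n : nat, (0 < n)%N -> has_moments P (d n).
Hypothesis b_moments : forall n : nat, (0 < n)%N -> has_moments P (b n).

Lemma has_moments_walk (n k : nat) (t : k.+1.-tuple 'I_n) :
  has_moments P (fun w => walk_weight (tridiag (d ^~ w) (b ^~ w) n) t).
Proof.
suff H i j : has_moments P (fun w => tridiag (d ^~ w) (b ^~ w) n i j).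
  exact: (has_moments_prod (index_enum 'I_k) (fun u =>
    H (tnth t (widen_ord (leqnSn k) u)) (tnth t (lift ord0 u)))).
rewrite (_ : (fun w => _) = fun w => if i == j then d (n - i)%N w
  else if (i.+1 == j :> nat) then b (n - j)%N w
  else if (j.+1 == i :> nat) then b (n - i)%N w else 0); last first.
  by apply/funext => w; rewrite mxE.
have pos (l : 'I_n) : (0 < n - l)%N by rewrite subn_gt0.
have h0 : has_moments P (fun=> 0) by exact: has_moments_cst.
case: (i == j); first exact: d_moments.
case: (i.+1 == j :> nat); first exact: b_moments.
by case: (j.+1 == i :> nat) => //; exact: b_moments.
Qed.

Lemma integrable_top_walks (n k : nat) :
  P.-integrable setT
    (EFin \o (fun w => top_walks_weight (d ^~ w) (b ^~ w) n k)).
Proof.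
have -> : EFin \o (fun w => top_walks_weight (d ^~ w) (b ^~ w) n k) =
    (fun w => \sum_(t : k.+1.-tuple 'I_n.+1 | closed_walk t && (ord0 \in t))
      (EFin \o (fun w => walk_weight (tridiag (d ^~ w) (b ^~ w) n.+1) t)) w)%E.
  by apply/funext => w; rewrite /= /top_walks_weight -sumEFin.
apply: integrable_sum => // t _; apply: has_moments_integrable.
exact: has_moments_walk.
Qed.

(** The variables involved have pairwise distinct positions in the joint family
    because n > k; the map h below lists these positions. *)
Lemma expectation_path (k n : nat) (c f : 'I_k.+1 -> nat) : (k < n)%N ->
  \int[P]_w ((\prod_(i < k.+1) b (n - i)%N w ^+ c i) *
             (\prod_(i < k.+1) d (n.+1 - i)%N w ^+ f i)) =
  (\prod_(i < k.+1) \int[P]_w (b (n - i)%N w ^+ c i)) *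
  (\prod_(i < k.+1) \int[P]_w (d (n.+1 - i)%N w ^+ f i)).
Proof.
move=> kn.
pose h (j : 'I_k.+1 + 'I_k.+1) : nat + nat :=
  match j with inl i => inr (n - i).-1 | inr i => inl (n - i)%N end.
have hinj : injective h.
  move=> [i|i] [j|j] //= [] ij; congr (_ _); apply: val_inj => /=;
    by have := ltn_ord i; have := ltn_ord j; lia.
pose F (j : 'I_k.+1 + 'I_k.+1) (x : R) :=
  x ^+ match j with inl i => c i | inr i => f i end.
have mF j : measurable_fun setT (F j) by exact: exprn_measurable.
have hb (i : 'I_k.+1) : joint_family d b (h (inl i)) = b (n - i)%N.
  by rewrite /= prednK// subn_gt0; have := ltn_ord i; lia.
have hd (i : 'I_k.+1) : joint_family d b (h (inr i)) = d (n.+1 - i)%N.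
  by rewrite /= subSn//; have := ltn_ord i; lia.
have mj j : has_moments P (F j \o (joint_family d b \o h) j).
  apply: has_momentsX; case: j => i /=.
    exact: b_moments.
  exact: d_moments.
have := independent_expectation_prod (mutually_independent_inj hinj indep)
  (index_enum_uniq _) mF mj.
rewrite big_sumType /=.
under eq_Rintegral do rewrite big_sumType /=.
have E1 w : \prod_(i < k.+1) F (inl i) ((joint_family d b \o h) (inl i) w) =
  \prod_(i < k.+1) b (n - i)%N w ^+ c i.
  by apply: eq_bigr => i _; rewrite /F /comp hb.
have E2 w : \prod_(i < k.+1) F (inr i) ((joint_family d b \o h) (inr i) w) =
  \prod_(i < k.+1) d (n.+1 - i)%N w ^+ f i.
  by apply: eq_bigr => i _; rewrite /F /comp hd.
under eq_Rintegral do rewrite E1 E2.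
move=> ->; congr (_ * _); apply: eq_bigr => i _.
  by rewrite -hb.
by rewrite -hd.
Qed.

Lemma expectation_top_walks (n k : nat) : (k < n)%N ->
  \int[P]_w top_walks_weight (d ^~ w) (b ^~ w) n k =
  \sum_(g \in top_paths k)
    (\prod_(i < k.+1)
       \int[P]_w (b (n.+1 - i.+1)%N w ^+ crossings g (- i.+1%:Z))) *
    (\prod_(i < k.+1) \int[P]_w (d (n.+1 - i)%N w ^+ flats g (- (i : nat)%:Z))).
Proof.
move=> kn; rewrite fsbig_finite; last exact: finite_top_paths.
have E w := top_walks_weightE (d ^~ w) (b ^~ w) (ltnW kn).
under eq_Rintegral => w _.
  rewrite E fsbig_finite; last exact: finite_top_paths.
  over.
rewrite Rintegral_sum => [|g].
  by apply: eq_bigr => g _; exact: expectation_path.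
apply: has_moments_integrable.
apply: has_momentsM; apply: has_moments_prod => i.
  by apply/has_momentsX/b_moments; have := ltn_ord i; lia.
by apply/has_momentsX/d_moments; have := ltn_ord i; lia.
Qed.

Lemma expectation_ntrace (alpha : R) (n k : nat) :
  'E_P[(fun w =>
    ntrace (scaled_tridiag alpha (d ^~ w) (b ^~ w) n ^+ k)%R)]%E =
  (n%:R^-1 * ((n%:R `^ (- alpha)) ^+ k *
    \sum_(l < n) \int[P]_w top_walks_weight (d ^~ w) (b ^~ w) l k))%:E.
Proof.
pose Z w := n%:R^-1 * ((n%:R `^ (- alpha)) ^+ k *
  \sum_(l < n) top_walks_weight (d ^~ w) (b ^~ w) l k).
have iS : P.-integrable setT (EFin \o (fun w =>
    \sum_(l < n) top_walks_weight (d ^~ w) (b ^~ w) l k)).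
  rewrite (_ : EFin \o _ = (fun w => \sum_(l < n)
    (EFin \o (fun w => top_walks_weight (d ^~ w) (b ^~ w) l k)) w)%E).
    by apply: integrable_sum => // l _; exact: integrable_top_walks.
  by apply/funext => w; rewrite /= -sumEFin.
have scale (c : R) f : P.-integrable setT (EFin \o f) ->
    P.-integrable setT (EFin \o (fun w => c * f w)).
  by move=> /(integrableZl measurableT c).
have iZ : P.-integrable setT (EFin \o Z) by exact: (scale _ _ (scale _ _ iS)).
rewrite (_ : (fun w => _) = Z); last first.
  by apply/funext => w; rewrite ntrace_scaled.
rewrite unlock -[LHS]fineK; last exact: integrable_fin_num.
rewrite -/(Rintegral P setT Z) /Z RintegralZl ?RintegralZl//.
  by rewrite Rintegral_sum// => l; exact: integrable_top_walks.
exact: scale.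
Qed.

End RandomTridiagonal.

(** * The limit of the mean moments *)

Lemma expansion_sum (R : realType) (u : R) (I : eqType) (r : seq I)
    (x : I -> nat -> R) (p q : I -> R) :
  (forall i, i \in r -> expansion u (x i) (p i) (q i)) ->
  expansion u (fun n => \sum_(i <- r) x i n)
    (\sum_(i <- r) p i) (\sum_(i <- r) q i).
Proof.
elim: r => [|i r IH] h.
  by rewrite !big_nil; under eq_fun do rewrite big_nil; exact: expansion_cst.
rewrite !big_cons; under eq_fun do rewrite big_cons.
rewrite /expansion (_ : (fun n => _) = (fun n => n%:R `^ u * (x i n - p i) +
  n%:R `^ u * (\sum_(j <- r) x j n - \sum_(j <- r) p j))); last first.
  by apply/funext => n; ring.
apply: cvgD; first by apply: h; rewrite mem_head.
by apply: IH => j jr; apply: h; rewrite inE jr orbT.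
Qed.

Lemma Gamma_top_paths (k : nat) : Gamma k `<=` top_paths k.
Proof. by move=> g []. Qed.

Lemma Gamma2_top_paths (k : nat) : Gamma2 k `<=` top_paths k.
Proof. by move=> g []. Qed.

(** Lets the expansions be summed over one finite set, top_paths, although the
    limits are sums over the subsets Gamma and Gamma2. *)
Lemma sum_sub_top_paths (R : realType) (k : nat) (G : set (k.+1.-tuple int))
    (F : k.+1.-tuple int -> R) : G `<=` top_paths k ->
  \sum_(g <- fset_set (top_paths k)) (if `[< G g >] then F g else 0) =
  \sum_(g \in G) F g.
Proof.
move=> Gtop; rewrite -[in RHS](setIidr Gtop) fsbig_mkcondr.
rewrite fsbig_finite; last exact: finite_top_paths.
apply: eq_bigr => g _; case: asboolP => [Gg|nGg]; first by rewrite mem_set.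
by rewrite memNset.
Qed.

Lemma Gamma_odd (k : nat) : odd k -> Gamma k = set0.
Proof.
move=> ok; rewrite -subset0 => g [pg _ f0].
by have := odd_flat_steps pg; rewrite f0 cards0 ok.
Qed.

Lemma Gamma2_odd (k : nat) : odd k -> Gamma2 k = set0.
Proof.
move=> ok; rewrite -subset0 => g [pg _ f2 _].
by have := odd_flat_steps pg; rewrite f2 ok.
Qed.

Section MomentExpansion.
Context (R : realType) (disp : measure_display) (T : measurableType disp).
Variables (P : probability T R) (alpha : R) (d b : nat -> {RV P >-> R}).
Variables (m xi : nat -> R) (u sigma : R).
Hypothesis alpha_gt0 : 0 < alpha.
Hypothesis indep : mutually_independent (joint_family d b).
Hypothesis d_moments : forall n : nat, (0 < n)%N -> has_moments P (d n).
Hypothesis b_moments : forall n : nat, (0 < n)%N -> has_moments P (b n).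
Hypotheses (u_gt0 : 0 < u) (u_le1 : u <= 1) (u_le2a : u <= 2 * alpha).
Hypothesis m0 : m 0%N = 1.

Let Bm c n := \int[P]_w (b n w ^+ c).
Let Dm c n := \int[P]_w (d n w ^+ c).

Hypothesis hB : forall c,
  expansion u (fun n => Bm c n / (n%:R `^ alpha) ^+ c) (m c) (xi c).
Hypothesis Dm1 : forall n, (0 < n)%N -> Dm 1 n = 0.
Hypothesis Dm2 : Dm 2 n @[n --> \oo] --> sigma ^+ 2.
Hypothesis Dm_bounded : forall f, exists C : R, forall n, (0 < n)%N ->
  `|Dm f n| <= C.

Lemma moment0 (X : T -> R) : \int[P]_w (X w ^+ 0) = 1.
Proof.
under eq_Rintegral do rewrite expr0.
rewrite Rintegral_cst// mul1r -[RHS]/(fine 1%:E).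
by congr fine; exact: probability_setT.
Qed.

(** The moment of order 0 equals 1 for every n, hence has no fluctuation. *)
Lemma xi_0 : xi 0%N = 0.
Proof.
have h : (fun n => n%:R `^ u * (Bm 0 n / (n%:R `^ alpha) ^+ 0 - m 0)) n
    @[n --> \oo] --> (0 : R).
  under eq_fun do rewrite /Bm moment0 m0 divr1 subrr mulr0.
  exact: cvg_cst.
exact: (cvg_unique _ (@hB 0%N) h).
Qed.

(** The predecessor n.-1 makes the matrix of size n appear, so that its topmost
    walks are measured against n ^ (alpha k). *)
Lemma top_walks_expansion (k : nat) :
  expansion u
    (fun n => (\int[P]_w top_walks_weight (d ^~ w) (b ^~ w) n.-1 k) /
              n%:R `^ (alpha * k%:R))
    (\sum_(g \in Gamma k) Mweight m g)
    (\sum_(g \in Gamma k) Xiweight m xi g +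
     (u == 1)%:R * (alpha * \sum_(g \in Gamma k) level_sum R g * Mweight m g) +
     (u == 2 * alpha)%:R * (sigma ^+ 2 * \sum_(g \in Gamma2 k) Mweight m g)).
Proof.
pose x (g : k.+1.-tuple int) n :=
  (\prod_(i < k.+1) Bm (crossings g (- i.+1%:Z)) (n - i.+1)%N) *
  (\prod_(i < k.+1) Dm (flats g (- (i : nat)%:Z)) (n - i)%N) /
  (n%:R `^ alpha) ^+ k.
have hx (g : k.+1.-tuple int) : top_paths k g -> expansion u (x g)
    (if `[< Gamma k g >] then Mweight m g else 0)
    ((if `[< Gamma k g >] then
        Xiweight m xi g + (u == 1)%:R * (alpha * (level_sum R g * Mweight m g))
      else 0) +
     (if `[< Gamma2 k g >] then
        (u == 2 * alpha)%:R * sigma ^+ 2 * Mweight m g else 0)).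
  move=> pg; apply: path_expansion => //; first exact: xi_0.
  by move=> n; exact: moment0.
have topP g : g \in fset_set (top_paths k) -> top_paths k g.
  by rewrite in_fset_set; [move/set_mem | exact: finite_top_paths].
have finG : finite_set (Gamma k).
  exact: sub_finite_set (@Gamma_top_paths k) (finite_top_paths k).
have finG2 : finite_set (Gamma2 k).
  exact: sub_finite_set (@Gamma2_top_paths k) (finite_top_paths k).
have h := @expansion_sum _ u _ (fset_set (top_paths k)) x _ _
  (fun g gs => hx g (topP g gs)).
rewrite big_split /= !(sum_sub_top_paths _ (@Gamma_top_paths k))
  (sum_sub_top_paths _ (@Gamma2_top_paths k)) in h.
have <- : \sum_(g \in Gamma k) (Xiweight m xi g +
      (u == 1)%:R * (alpha * (level_sum R g * Mweight m g))) +
    \sum_(g \in Gamma2 k) (u == 2 * alpha)%:R * sigma ^+ 2 * Mweight m g =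
    \sum_(g \in Gamma k) Xiweight m xi g +
     (u == 1)%:R * (alpha * \sum_(g \in Gamma k) level_sum R g * Mweight m g) +
     (u == 2 * alpha)%:R * (sigma ^+ 2 * \sum_(g \in Gamma2 k) Mweight m g).
  rewrite !fsbig_finite//.
  by rewrite big_split /= -!mulr_sumr -!mulrA.
apply: eq_expansion h; near=> n.
have nk : (k.+1 < n)%N by near: n; exists k.+2.
have nE : n = n.-1.+1 by lia.
rewrite expectation_top_walks//; last by lia.
rewrite fsbig_finite; last exact: finite_top_paths.
rewrite mulr_suml; apply: eq_bigr => g _.
by rewrite /x -!nE powRrM powR_mulrn// powR_ge0.
Unshelve. all: by end_near. Qed.

Lemma ntrace_expansion (k : nat) : (0 < k)%N ->
  expansion u
    (fun n => n%:R^-1 * ((n%:R `^ (- alpha)) ^+ k *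
       \sum_(l < n) \int[P]_w top_walks_weight (d ^~ w) (b ^~ w) l k))
    ((\sum_(g \in Gamma k) Mweight m g) / (alpha * k%:R + 1))
    ((\sum_(g \in Gamma k) Xiweight m xi g +
      (u == 1)%:R * (alpha * \sum_(g \in Gamma k) level_sum R g * Mweight m g) +
      (u == 2 * alpha)%:R * (sigma ^+ 2 * \sum_(g \in Gamma2 k) Mweight m g) +
      (u == 1)%:R *
        ((\sum_(g \in Gamma k) Mweight m g) * (alpha * k%:R / 2))) /
     (alpha * k%:R + 1 - u)).
Proof.
move=> k0.
have p0 : 0 < alpha * k%:R by rewrite mulr_gt0 ?ltr0n.
have h := mean_power_expansion p0 u_gt0 u_le1 (@top_walks_expansion k).
apply: eq_expansion h; near=> n.
have n0 : (0 < n)%N by near: n; exists 1%N.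
have nn : (n%:R : R) != 0 by rewrite pnatr_eq0 -lt0n.
rewrite powRD ?nn ?implybT// powRr1// powRrM powR_mulrn ?powR_ge0//.
rewrite powRN exprVn invfM /=; ring.
Unshelve. all: by end_near. Qed.

End MomentExpansion.

Lemma top_walks_weight0 (R : comNzRingType) (d b : nat -> R) (n : nat) :
  top_walks_weight d b n 0 = 1.
Proof.
have := trace_tridiag_recr d b n 0; rewrite !expr0 !mxtrace1 -natr1.
by move/addrI => <-.
Qed.

Lemma limit_moment0 (R : realType) (alpha : R) (m : nat -> R) :
  m 0%N = 1 -> limit_moment alpha m 0 = 1.
Proof.
move=> m0; rewrite /limit_moment /= mulr0 add0r invr1 mul1r.
have G0 : Gamma 0 = [set [tuple 0]].
  apply/seteqP; split => [g [_ gm _]|g ->] /=.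
    apply: eq_from_tnth => i; rewrite (ord1 i) (tnth_nth 0) (tnth_nth 0) /=.
    by move/path_max0P: gm => [_ [v]]; rewrite (ord1 v).
  split; first by split => // -[].
    by apply/path_max0P; split => [v|]; [|exists ord0]; rewrite ?(ord1 v).
  by apply/setP => -[].
have G0top : top_paths 0 [tuple 0].
  by apply: (@Gamma_top_paths 0); rewrite G0.
rewrite G0 fsbig_set1 MweightE// big1// => i _.
rewrite (_ : crossings _ _ = 0%N)//.
by apply/eqP; rewrite cards_eq0; apply/eqP/setP => -[].
Qed.

Theorem theorem2 (R : realType) (disp : measure_display)
    (T : measurableType disp) (P : probability T R)
    (alpha : R) (d b : nat -> {RV P >-> R}) (m : nat -> R)
    (upsilon sigma_d : R) (xi : nat -> R)
    (alpha_gt0 : 0 < alpha)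
    (indep : mutually_independent (joint_family d b))
    (d_moments : forall n : nat, (0 < n)%N -> finite_moments (d n))
    (b_moments : forall n : nat, (0 < n)%N -> finite_moments (b n))
    (m0 : m 0%N = 1)
    (b_limit : forall k : nat,
      'E_P[(fun w => ((b n w / n%:R `^ alpha) ^+ k)%R)]%E @[n --> \oo]
        --> (m k)%:E)
    (d_bounded : forall k : nat,
      (ereal_sup [set 'E_P[(fun w => (`|d n w| ^+ k)%R)] | n in [set n | (0 < n)%N]]
        < +oo)%E)
    (upsilon_gt0 : 0 < upsilon)
    (upsilon_le : upsilon <= Num.min 1 (2 * alpha))
    (b_rate : forall k : nat,
      ((n%:R `^ upsilon)%:E *
        ('E_P[(fun w => ((b n w / n%:R `^ alpha) ^+ k)%R)] - (m k)%:E))%E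
        @[n --> \oo] --> (xi k)%:E)
    (d_centered : forall n : nat, (0 < n)%N -> 'E_P[d n]%E = 0%E)
    (d_variance : 'V_P[d n]%E @[n --> \oo] --> (sigma_d ^+ 2)%:E)
    (k : nat) :
  let converges_to (l : R) :=
    ((n%:R `^ upsilon)%:E *
      ('E_P[(fun w =>
          ntrace (scaled_tridiag alpha (d ^~ w) (b ^~ w) n ^+ k)%R)]
        - (limit_moment alpha m k)%:E))%E
      @[n --> \oo] --> l%:E in
  [/\ odd k \/ k = 0%N -> converges_to 0,
      (2 <= k)%N -> ~~ odd k -> upsilon < Num.min 1 (2 * alpha) ->
        converges_to ((alpha * k%:R - upsilon + 1)^-1 *
          \sum_(g \in Gamma k) Xiweight m xi g),
      (2 <= k)%N -> ~~ odd k -> upsilon = 2 * alpha -> 2 * alpha < 1 ->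
        converges_to ((alpha * k%:R - upsilon + 1)^-1 *
          (sigma_d ^+ 2 * \sum_(g \in Gamma2 k) Mweight m g +
           \sum_(g \in Gamma k) Xiweight m xi g)),
      (2 <= k)%N -> ~~ odd k -> upsilon = 1 -> 1 < 2 * alpha ->
        converges_to ((alpha * k%:R + 1) / 2 * limit_moment alpha m k +
          k%:R^-1 * (\sum_(g \in Gamma k) level_sum R g * Mweight m g) +
          (alpha * k%:R)^-1 * \sum_(g \in Gamma k) Xiweight m xi g) &
      (2 <= k)%N -> ~~ odd k -> upsilon = 1 -> 2 * alpha = 1 ->
        converges_to ((k%:R + 2) / 4 * limit_moment alpha m k +
          k%:R^-1 * (\sum_(g \in Gamma k) level_sum R g * Mweight m g) +
          2 / k%:R * sigma_d ^+ 2 * \sum_(g \in Gamma2 k) Mweight m g +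
          2 / k%:R * \sum_(g \in Gamma k) Xiweight m xi g)].
Proof.
have iX (X : nat -> {RV P >-> R}) c n : finite_moments (X n) ->
    (\int[P]_w (X n w ^+ c)%:E = (\int[P]_w (X n w ^+ c))%:E)%E.
  by move=> mX; rewrite /Rintegral fineK//; apply: integrable_fin_num => //;
    exact: mX.
have u_le1 : upsilon <= 1.
  by apply: le_trans upsilon_le _; rewrite ge_min lexx.
have u_le2a : upsilon <= 2 * alpha.
  by apply: le_trans upsilon_le _; rewrite ge_min lexx orbT.
have hB c : expansion upsilon
    (fun n => (\int[P]_w (b n w ^+ c)) / (n%:R `^ alpha) ^+ c) (m c) (xi c).
  refine (proj1 (near_cvg_EFin _ _) (b_rate c)); near=> n.
  have n0 : (0 < n)%N by near: n; exists 1%N.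
  rewrite unlock (_ : (fun w => _) = (fun w =>
    ((n%:R `^ alpha) ^- c)%:E * (b n w ^+ c)%:E)%E); last first.
    by apply/funext => w; rewrite -EFinM expr_div_n mulrC.
  rewrite integralZl//; last exact: b_moments.
  rewrite iX; last exact: b_moments.
  by rewrite [in RHS](mulrC (\int[P]_w _)).
have Dm1 n : (0 < n)%N -> \int[P]_w (d n w ^+ 1) = 0.
  move=> n0; have := d_centered n n0; rewrite unlock => d0.
  by under eq_Rintegral do rewrite expr1; rewrite /Rintegral d0.
have Dm2 : \int[P]_w (d n w ^+ 2) @[n --> \oo] --> sigma_d ^+ 2.
  refine (proj1 (near_cvg_EFin _ _) d_variance); near=> n.
  have n0 : (0 < n)%N by near: n; exists 1%N.
  rewrite -iX; last exact: d_moments.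
  rewrite /variance covariance.unlock d_centered//= unlock; apply: eq_integral => w _.
  by rewrite -[LHS]/((d n w - 0) * (d n w - 0))%:E subr0 expr2.
have Dm_bounded f : exists C : R, forall n, (0 < n)%N ->
    `|\int[P]_w (d n w ^+ f)| <= C.
  have := d_bounded f; set M := ereal_sup _ => Mlty.
  exists (fine M) => n n0.
  have id : P.-integrable setT (EFin \o (fun w => d n w ^+ f)).
    exact: d_moments.
  apply: (le_trans (le_normr_Rintegral measurableT id)).
  have E : (\int[P]_w `|d n w ^+ f|)%:E = 'E_P[(fun w => (`|d n w| ^+ f)%R)]%E.
    rewrite unlock /Rintegral fineK; last first.
      by apply: integrable_fin_num => //; exact: integrable_norm.
    by apply: eq_integral => w _; rewrite normrX.
  have EM : ((\int[P]_w `|d n w ^+ f|)%:E <= M)%E.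
    by rewrite E; apply: ereal_sup_ubound; exists n.
  have Mfin : M \is a fin_num.
    rewrite fin_numE -ltNye -ltey Mlty andbT.
    by apply: lt_le_trans EM; exact: ltNyr.
  by rewrite -lee_fin (fineK Mfin).
have main l : 
    expansion upsilon (fun n => n%:R^-1 * ((n%:R `^ (- alpha)) ^+ k *
       \sum_(l < n) \int[P]_w top_walks_weight (d ^~ w) (b ^~ w) l k))
      (limit_moment alpha m k) l ->
    ((n%:R `^ upsilon)%:E *
      ('E_P[(fun w =>
          ntrace (scaled_tridiag alpha (d ^~ w) (b ^~ w) n ^+ k)%R)]
        - (limit_moment alpha m k)%:E))%E
      @[n --> \oo] --> l%:E.
  move=> hl; refine (proj2 (near_cvg_EFin _ _) hl); apply: nearW => n.
  by rewrite expectation_ntrace.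
have hk := @ntrace_expansion _ _ _ P alpha d b m xi upsilon sigma_d alpha_gt0
  indep d_moments b_moments upsilon_gt0 u_le1 u_le2a m0 hB Dm1 Dm2 Dm_bounded k.
set SM := \sum_(g \in Gamma k) Mweight m g in hk *.
set SX := \sum_(g \in Gamma k) Xiweight m xi g in hk *.
set SL := \sum_(g \in Gamma k) _ in hk *.
set SM2 := \sum_(g \in Gamma2 k) _ in hk *.
move=> converges_to.
have even_case l : (2 <= k)%N -> ~~ odd k ->
    l = (SX + (upsilon == 1)%:R * (alpha * SL) +
      (upsilon == 2 * alpha)%:R * (sigma_d ^+ 2 * SM2) +
      (upsilon == 1)%:R * (SM * (alpha * k%:R / 2))) /
     (alpha * k%:R + 1 - upsilon) -> converges_to l.
  move=> k2 ek ->; apply: main; rewrite /limit_moment (negPf ek) mulrC.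
  by apply: hk; lia.
have kn0 : (2 <= k)%N -> k%:R != 0 :> R by move=> k2; rewrite pnatr_eq0; lia.
have a0 : alpha != 0 by rewrite gt_eqF.
have p0 : 0 <= alpha * k%:R by rewrite mulr_ge0// ltW.
split.
- have [ok _|ek [//|kz]] := boolP (odd k).
    apply: main; rewrite /limit_moment ok.
    have := hk (odd_gt0 ok).
    rewrite /SM /SX /SL /SM2 Gamma_odd// Gamma2_odd// !fsbig_set0.
    by rewrite !mul0r !mulr0 !addr0 mul0r.
  apply: main; rewrite kz limit_moment0//.
  have h : (fun=> 0 : R) n @[n --> \oo] --> (0 : R) by exact: cvg_cst.
  apply: cvg_trans h; apply: near_eq_cvg; near=> n.
  have n0 : (0 < n)%N by near: n; exists 1%N.
  have nn : (n%:R : R) != 0 by rewrite pnatr_eq0 -lt0n.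
  rewrite (eq_bigr (fun=> 1)) => [|l _].
    by rewrite sumr_const card_ord expr0 mul1r mulVf// subrr mulr0.
  under eq_Rintegral do rewrite top_walks_weight0.
  exact: (@moment0 _ _ _ P (fun=> 0)).
- move=> k2 ek; rewrite lt_min => /andP[u1 u2]; apply: even_case => //.
  rewrite !lt_eqF// !mul0r !addr0 mulrC; congr (_ / _); ring.
- move=> k2 ek u2 a1; apply: even_case => //.
  rewrite u2 eqxx (lt_eqF a1) !mul0r !addr0 mul1r mulrC addrC.
  by rewrite [SX + _]addrC; congr (_ / _); ring.
- move=> k2 ek u1 a1; apply: even_case => //.
  rewrite u1 eqxx (lt_eqF a1) !mul0r !mul1r !addr0 /limit_moment (negPf ek).
  rewrite -/SM; field.
  by rewrite addrK mulf_neq0 ?kn0 ?a0 //= gt_eqF// ltr_wpDl.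
- move=> k2 ek u1 a1; apply: even_case => //.
  rewrite u1 a1 eqxx !mul1r /limit_moment (negPf ek) -/SM.
  have -> : alpha = 1 / 2 by lra.
  field.
  by rewrite addrK kn0//= gt_eqF// ltr_wpDl.
Unshelve. all: by end_near. Qed.
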